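(* Let $k=\mathbb C$ and let $p$ be a prime number. Let $G=\langle\sigma\rangle$ be a cyclic group of order $p$ acting on a nonsingular projective curve $Y$ over $k$ such that the quotient map is $\pi : Y\to\mathbb P^1$. Assume $Y$ has positive genus $g(Y)>0$. Then for a sufficiently general point $Q\in\mathbb P^1$, if $X=\pi^{-1}(\mathbb P^1-Q)$, then $\mathcal O^\ast(X)=k^\ast$.
   Context: $\mathcal O(X)$ is the ring of regular functions on $X$ and $\mathcal O^\ast(X)$ is its group of units. Curves are irreducible. ''For a sufficiently general point $Q\in\mathbb P^1$'' means: for all closed points $Q$ of $\mathbb P^1$ outside some countable subset (depending on $Y$ and $\pi$). *)

(* Defs.v *)
(* Classical varieties in projective space over an algebraically closed field
   (Hartshorne, Chapter I), in MathComp. *)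
From HB Require Import structures.
From mathcomp Require Import all_boot all_order all_algebra all_fingroup.
From mathcomp Require Import mpoly.
From mathcomp Require Import boolp classical_sets cardinality reals complex.

Set Implicit Arguments.
Unset Strict Implicit.
Unset Printing Implicit Defensive.

Import GRing.Theory.
Local Open Scope ring_scope.
Local Open Scope classical_set_scope.

Definition projspace (k : fieldType) (n : nat) : Type :=
  {L : {vspace 'rV[k]_n.+1} | \dim L == 1%N}.

Section Varieties.
Variables (k : closedFieldType) (n : nat).
Implicit Types (Z : set (projspace k n)) (h : {mpoly k[n.+1]}).

(* Homogeneous coordinates depend on the choice of a nonzero vector of the
   line.  They are only used for vanishing of homogeneous polynomials and for
   quotients of two homogeneous polynomials of equal degree, where the choice
   is irrelevant. *)
Definition hcoord (x : projspace k n) : 'I_n.+1 -> k :=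
  fun i => vpick (sval x) ord0 i.

Definition heval h (x : projspace k n) : k := h.@[hcoord x].

Definition zariski_closed Z : Prop :=
  exists S : set {mpoly k[n.+1]},
    (forall h, S h -> exists d : nat, h \is d.-homog) /\
    Z = [set x | forall h, S h -> heval h x = 0].

Definition irreducible_set Z : Prop :=
  Z !=set0 /\
  forall Z1 Z2, zariski_closed Z1 -> zariski_closed Z2 ->
    Z `<=` Z1 `|` Z2 -> Z `<=` Z1 \/ Z `<=` Z2.

Definition closed_chain Z (d : nat) : Prop :=
  exists C : nat -> set (projspace k n),
    (forall i, (i <= d)%N ->
       [/\ zariski_closed (C i), irreducible_set (C i) & C i `<=` Z]) /\
    (forall i, (i < d)%N -> C i `<=` C i.+1 /\ C i <> C i.+1).

(* Krull dimension of the closed set Z.  Chains can be truncated, so it is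
   enough to exclude length d.+1. *)
Definition has_dimension Z (d : nat) : Prop :=
  closed_chain Z d /\ ~ closed_chain Z d.+1.

End Varieties.

Section Functions.
Variables (k : closedFieldType) (n : nat) (Y : set (projspace k n)).
Implicit Types (U V W : set Y) (f u : Y -> k) (x y : Y).

Definition zariski_open U : Prop :=
  exists Z, zariski_closed Z /\ U = [set y : Y | ~ Z (val y)].

(* Only the values of f on U matter. *)
Definition regular U f : Prop :=
  forall x, U x -> exists V (d : nat) (a b : {mpoly k[n.+1]}),
    [/\ zariski_open V, V x, a \is d.-homog, b \is d.-homog &
        forall y, U y -> V y ->
          heval b (val y) != 0 /\ f y = heval a (val y) / heval b (val y)].

Definition regular_unit U f : Prop :=
  regular U f /\
  exists u, regular U u /\ forall y, U y -> f y * u y = 1.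

Definition regular_at x f : Prop :=
  exists U, [/\ zariski_open U, U x & regular U f].

Definition near_eq x f u : Prop :=
  exists U, [/\ zariski_open U, U x & forall y, U y -> f y = u y].

(* The local ring at x is regular of dimension d: its maximal ideal is
   generated by d germs.  It is meant for Y irreducible of dimension d, where
   the local ring at every (closed) point has Krull dimension d. *)
Definition nonsingular_at (d : nat) x : Prop :=
  exists t : 'I_d -> Y -> k,
    (forall i, regular_at x (t i) /\ t i x = 0) /\
    forall f, regular_at x f -> f x = 0 ->
      exists a : 'I_d -> Y -> k,
        (forall i, regular_at x (a i)) /\
        near_eq x f (fun y => \sum_(i < d) a i y * t i y).

Definition nonsingular_projective_curve : Prop :=
  [/\ zariski_closed Y, irreducible_set Y, has_dimension Y 1 &
      forall x, nonsingular_at 1 x].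

Definition point_derivation x (D : (Y -> k) -> k) : Prop :=
  [/\ forall f u, regular_at x f -> regular_at x u -> near_eq x f u ->
        D f = D u,
      forall (c : k) f u, regular_at x f -> regular_at x u ->
        D (fun y => c * f y + u y) = c * D f + D u &
      forall f u, regular_at x f -> regular_at x u ->
        D (fun y => f y * u y) = f x * D u + u x * D f].

Definition tangent_space x : Type :=
  {D : (Y -> k) -> k | point_derivation x D}.

Definition covector_field : Type := forall x, tangent_space x -> k.

(* Regular differential 1-forms as fields of covectors that are locally
   sum_i a_i d b_i with a_i, b_i regular (Shafarevich, Chapter III); here
   (d b)_y is the covector D |-> D b.  On a nonsingular Y this is
   H^0(Y, Omega_Y). *)
Definition regular_form (w : covector_field) : Prop :=
  forall x, exists U (m : nat) (a b : 'I_m -> Y -> k),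
    [/\ zariski_open U, U x,
        forall i, regular U (a i) /\ regular U (b i) &
        forall y, U y -> forall D : tangent_space y,
          w y D = \sum_(i < m) a i y * sval D (b i)].

(* g is the dimension of the space of regular differential 1-forms. *)
Definition has_genus (g : nat) : Prop :=
  exists w : 'I_g -> covector_field,
    [/\ forall i, regular_form (w i),
        forall c : 'I_g -> k,
          (forall y (D : tangent_space y), \sum_(i < g) c i * w i y D = 0) ->
          forall i, c i = 0 &
        forall v, regular_form v -> exists c : 'I_g -> k,
          forall y (D : tangent_space y), v y D = \sum_(i < g) c i * w i y D].

End Functions.

Definition morphism_of_varieties (k : closedFieldType) (n m : nat)
    (Y : set (projspace k n)) (Z : set (projspace k m)) (phi : Y -> Z) : Prop :=
  forall V : set Z, zariski_open V ->
    zariski_open (phi @^-1` V) /\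
    forall f : Z -> k, regular V f -> regular (phi @^-1` V) (f \o phi).

Definition projective_line (k : closedFieldType) : set (projspace k 1) := setT.
Arguments projective_line k : clear implicits.

Section Quotients.
Variables (k : closedFieldType) (n m : nat).
Variables (Y : set (projspace k n)) (Z : set (projspace k m)).
Variables (gT : finGroupType) (G : {group gT}) (act : action G Y).

Definition algebraic_action : Prop :=
  forall a, a \in G -> morphism_of_varieties (fun y : Y => act y a).

(* (Z, pi) is the quotient variety Y / G: as a topological space Z is the
   orbit space, and O_Z is the sheaf of G-invariants of pi_* O_Y. *)
Definition quotient_map (pi : Y -> Z) : Prop :=
  [/\ morphism_of_varieties pi,
      forall z, exists y, pi y = z,
      forall x y, pi x = pi y <-> exists2 a, a \in G & y = act x a,
      forall V : set Z, zariski_open (pi @^-1` V) -> zariski_open V &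
      forall (V : set Z) (f : Y -> k), zariski_open V ->
        regular (pi @^-1` V) f ->
        (forall y a, V (pi y) -> a \in G -> f (act y a) = f y) ->
        exists u : Z -> k, regular V u /\ forall y, V (pi y) -> f y = u (pi y)].

End Quotients.

(* Main.v *)
Require Import Defs.
From HB Require Import structures.
From mathcomp Require Import all_boot all_order all_algebra all_fingroup.
From mathcomp Require Import cyclic all_field mpoly ring zify.
From mathcomp Require Import boolp classical_sets functions cardinality reals
  complex.

(** Why the theorem holds.  Let f be a nonconstant unit on X and let P be a
point over Q.  If the orbit of P under the group is a point, or if f has the
same order at all translates of P, then f or its inverse is regular everywhere,
hence constant.  Otherwise the orders a_i of f at the points sigma^i P form a
nonconstant sequence of period p.  The polynomial with coefficients a_i is prime to
1 + X + ... + X^(p-1), which is irreducible over the rationals because p is prime,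
so Bezout's identity combines the conjugates of f into a function g whose divisor is
m P + c (sum of the orbit of P), with m > 0 ([cyclic_inverse]).

Compare two points Q, Q' which give the same integers m, c and the same
ramification index e.  Multiplying the e-th power of g / g' by a power of the
pullback of the function on the line with zero Q and pole Q' cancels the orbits,
and m e P is linearly equivalent to m e P'.  There are countably many triples
(m, c, e), so it suffices that, for a fixed P' and M > 0, only finitely many P
satisfy M P ~ M P' ([finite_torsion]).  This is where the positive genus enters.

The classical reason is that the Jacobian, in which Y embeds, has finitely many
points of order dividing M; a count of vanishing orders replaces it.  Let L be the
space of functions whose only pole is at P', of order at most M.  In characteristic
zero the vanishing orders of L at a general point are less than dim L
([general_vanishing]).  If infinitely many P had M P ~ M P', then some element of L
would vanish to order M at a general point, so dim L > M.  Adding one to the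
allowed pole order raises the dimension by at most one, so some function has
exactly one simple pole, at P' ([small_linear_system]).  Such a function h generates
the function field, and its differential computes every regular differential form
as a dh with a regular away from P' and vanishing at P'; hence a = 0 and there is no
nonzero regular form ([simple_pole_no_form]), against positive genus.

The tools are: Hilbert's basis theorem, which makes proper closed subsets of Y
finite and gives Krull's intersection theorem, hence orders of rational functions;
a derivation of the function field that is well behaved at almost all points
([derivation_ex]); and the constancy of functions regular on all of Y, which
descends through the norm to the projective line ([quotient_global_const]). *)

Set Implicit Arguments.
Unset Strict Implicit.
Unset Printing Implicit Defensive.

Import GRing.Theory Num.Theory Order.TTheory.
Local Open Scope ring_scope.
Local Open Scope classical_set_scope.

(** * Hilbert's basis theorem *)

(** Keep choosing the index of the least value among all later ones. *)
Lemma nat_nondecr_subseq (v : nat -> nat) :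
  exists phi : nat -> nat,
    {homo phi : a b / (a < b)%N} /\ {homo v \o phi : a b / (a <= b)%N}.
Proof.
have minv N : exists m, (N <= m)%N /\ forall l, (N <= l)%N -> (v m <= v l)%N.
  have ex : exists c, `[< exists2 m, (N <= m)%N & v m = c >].
    by exists (v N); apply/asboolP; exists N.
  case: (ex_minnP ex) => c /asboolP [m Nm vm] cmin.
  by exists m; split=> // l Nl; rewrite vm; apply: cmin; apply/asboolP; exists l.
pose g N := projT1 (cid (minv N)).
have gN N : (N <= g N)%N /\ forall l, (N <= l)%N -> (v (g N) <= v l)%N.
  exact: (projT2 (cid (minv N))).
pose phi a := iter a (fun N => g N.+1) (g 0%N).
exists phi; split.
  by apply: homo_ltn => [a b c|a]; [exact: ltn_trans|rewrite /phi iterS;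
    case: (gN (phi a).+1)].
apply: homo_leq => [a|a b c|a] //=; first exact: leq_trans.
have [N [phiN Na]] : exists N, phi a = g N /\ (N <= phi a)%N.
  by case: a => [|a]; [exists 0%N|exists (phi a).+1; split=> //; exact: (gN _).1].
rewrite {1}phiN; apply: (gN N).2; apply: leq_trans Na _.
by apply: ltnW; exact: (gN (phi a).+1).1.
Qed.

(** Dickson's lemma, by extracting a monotone subsequence one coordinate after
    the other. *)
Lemma mnm_nondecr_subseq n (v : nat -> 'X_{1..n}) :
  exists phi : nat -> nat,
    {homo phi : a b / (a < b)%N} /\
    forall a b, (a <= b)%N -> (v (phi a) <= v (phi b))%MM.
Proof.
suff H d : exists phi : nat -> nat, {homo phi : a b / (a < b)%N} /\
    forall a b, (a <= b)%N -> forall i : 'I_n, (i < d)%N ->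
      (v (phi a) i <= v (phi b) i)%N.
  have [phi [phi1 phi2]] := H n; exists phi; split=> // a b ab.
  by apply/mnm_lepP => i; apply: phi2.
elim: d => [|d [phi [phi1 phi2]]]; first by exists id; split.
case: (ltnP d n) => dn; last first.
  exists phi; split=> // a b ab i _; apply: phi2 => //.
  exact: leq_trans (ltn_ord i) dn.
have [psi [psi1 psi2]] := nat_nondecr_subseq (fun a => v (phi a) (Ordinal dn)).
exists (phi \o psi); split=> [a b ab|a b ab i]; first by apply: phi1; apply: psi1.
rewrite ltnS leq_eqVlt => /orP [/eqP id_|ltid].
  have -> : i = Ordinal dn by apply: val_inj.
  exact: psi2.
apply: phi2 => //; move: ab; rewrite leq_eqVlt => /orP [/eqP->//|/psi1].
exact: ltnW.
Qed.

(** If no term were a combination of the preceding ones, choose for every N an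
    element of the union of the ideals that lies outside the N-th ideal, with least
    leading monomial.  By Dickson's lemma one of these leading monomials divides a
    later one, and cancelling it gives an element with a smaller leading monomial. *)
Lemma hilbert_basis (k : fieldType) n (f : nat -> {mpoly k[n]}) :
  exists N (C : nat -> {mpoly k[n]}), f N = \sum_(i < N) C i * f i.
Proof.
pose I N g := exists C : nat -> {mpoly k[n]}, g = \sum_(i < N) C i * f i.
apply: contrapT => noN.
have fI N : ~ I N (f N) by move=> [C Cf]; apply: noN; exists N, C.
have IS N M g : (N <= M)%N -> I N g -> I M g.
  move=> NM [C ->]; exists (fun i => if (i < N)%N then C i else 0).
  rewrite (big_ord_widen M (fun i => C i * f i) NM) big_mkcond /=.
  by apply: eq_bigr => i _; case: ifP => // _; rewrite mul0r.
have IB N g h p : I N g -> I N h -> I N (g + p * h).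
  move=> [C ->] [D ->]; exists (fun i => C i + p * D i).
  rewrite mulr_sumr -big_split /=; apply: eq_bigr => i _.
  by rewrite mulrDl mulrA.
pose J g := exists N, I N g.
have minJ N : exists g, (J g /\ ~ I N g) /\
    forall h, J h /\ ~ I N h -> (mlead g <= mlead h)%O.
  apply: contrapT => nog.
  have H g : ~ (J g /\ ~ I N g).
    elim/mleadrect: g => g IHg Jg; apply: nog; exists g; split=> // h Jh.
    by case: leP => // lthg; case: (IHg h lthg Jh).
  apply: (H (f N)); split=> //; exists N.+1.
  exists (fun i => if i == N then 1 else 0).
  rewrite (bigD1 ord_max) //= eqxx mul1r big1 ?addr0 // => i.
  by rewrite -(inj_eq val_inj) /= => /negPf ->; rewrite mul0r.
pose h N := projT1 (cid (minJ N)).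
have hN N : (J (h N) /\ ~ I N (h N)) /\
    forall g, J g /\ ~ I N g -> (mlead (h N) <= mlead g)%O.
  exact: (projT2 (cid (minJ N))).
have [phi [phi1 phi2]] := mnm_nondecr_subseq (fun N => mlead (h N)).
have geqphi b : (b <= phi b)%N.
  by elim: b => // b IH; apply: leq_ltn_trans IH _; apply: phi1.
have [M hM] := (hN (phi 0)).1.1.
set p := h (phi 0%N) in hM *; set j := phi M.
have Ij : I j p by apply: IS hM; exact: geqphi.
have lepj : (mlead p <= mlead (h j))%MM by apply: phi2.
set q := h j in lepj *.
have [[Jq nIq] qmin] := hN j; rewrite -/q in Jq nIq qmin.
have p0 : p != 0.
  apply/eqP => p0; case: (hN (phi 0%N)) => -[_ + _]; rewrite -/p p0; apply.
  by exists (fun=> 0); rewrite big1 // => i _; rewrite mul0r.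
pose m := (mlead q - mlead p)%MM.
pose c := mleadc q / mleadc p.
(* The leading monomials of q and of the multiple of p cancel. *)
pose r := q + (- (c *: 'X_[m])) * p.
have nIr : ~ I j r.
  move=> Ir; apply: nIq; have := IB j _ _ (c *: 'X_[m]) Ir Ij.
  by rewrite /r mulNr subrK.
have Jr : J r.
  case: Jq => N1 I1; exists (maxn N1 j); apply: IB.
    exact: IS (leq_maxl _ _) I1.
  exact: IS (leq_maxr _ _) Ij.
have /qmin := conj Jr nIr.
have r0 : r != 0.
  apply/eqP => r0; apply: nIr; rewrite r0; exists (fun=> 0).
  by rewrite big1 // => i _; rewrite mul0r.
have mp0 : mleadc p != 0 by rewrite mleadc_eq0.
have c0 : c * mleadc p = mleadc q by rewrite /c divfK.
have Xp : (mlead ((- (c *: 'X_[m])) * p) <= mlead q)%O.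
  apply: le_trans (mleadM_le _ _) _; rewrite mleadN.
  have : (mlead (c *: 'X_[k, m]) <= m)%O.
    by apply: le_trans (mleadZ_le _ _) _; rewrite mleadXm.
  move=> H; rewrite -[leRHS](submK lepj).
  exact: lem_add.
have ler : (mlead r <= mlead q)%O.
  by apply: le_trans (mleadD_le _ _) _; rewrite leUx lexx Xp.
move=> leq_; have Er : mlead r = mlead q by apply/le_anti; rewrite ler leq_.
case/negP: r0; rewrite -mleadc_eq0 Er /r mcoeffD mulNr mcoeffN -scalerAl mcoeffZ.
have -> : ('X_[m] * p)@_(mlead q) = mleadc p.
  have -> : mlead q = (mlead p + m)%MM by rewrite addmC submK.
  by rewrite -commr_mpolyX addmC mcoeffMX.
by rewrite c0 subrr.
Qed.

(** * Inverting integer combinations of translates modulo the norm *)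

Local Notation pQtoC := (map_poly (ratr : rat -> algC)).

Lemma coef_sum_Xn (A : nzRingType) p j :
  (\sum_(i < p) 'X^i : {poly A})`_j = (j < p)%:R.
Proof.
rewrite coef_sum; have [jp|pj] := ltnP j p.
  rewrite (bigD1 (Ordinal jp)) //= coefXn eqxx big1 ?addr0 // => l.
  by rewrite -(inj_eq val_inj) /= coefXn eq_sym => /negPf ->.
by rewrite big1 // => l _; rewrite coefXn gtn_eqF // (leq_trans (ltn_ord l)).
Qed.

(** The sum is the minimal polynomial of a primitive p-th root of unity, hence
    irreducible; a multiple of it of degree less than p has equal coefficients. *)
Lemma prime_cyclotomic_coprime p (A : {poly rat}) : prime p ->
  (size A <= p)%N -> (exists i, (i < p)%N && (A`_i != A`_0)) ->
  coprimep A (\sum_(i < p) 'X^i).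
Proof.
move=> p_prime sA [i /andP [ip Ai]].
have sizes (u v : nat) : (0 < u)%N -> (0 < v)%N -> ((u + v).-1 <= u)%N -> v = 1%N.
  by lia.
have p1 := prime_gt1 p_prime; have p0 := ltnW p1.
set Phi := \sum_(i < p) 'X^i : {poly rat}.
have PhiX : Phi * ('X - 1) = 'X^p - 1 by rewrite [RHS]subrX1 mulrC.
have coefPhi j : Phi`_j = (j < p)%:R := coef_sum_Xn _ p j.
have sPhi : size Phi = p.
  apply/anti_leq/andP; split.
    by apply/leq_sizeP => j pj; rewrite coefPhi ltnNge pj.
  rewrite leqNgt -(prednK p0) ltnS; apply/negP =>
    /leq_sizeP /(_ p.-1 (leqnn _)) /eqP.
  by rewrite coefPhi prednK // leqnn oner_eq0.
have [z z_prim] := C_prim_root_exists p0.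
have [q [mq qmon] qdvd] := minCpolyP z.
have sq : size q = p.
  have : size (minCpoly z) = size q by rewrite mq size_map_poly.
  rewrite (minCpoly_cyclotomic z_prim) size_cyclotomic totient_prime // prednK //.
have z1 : z != 1.
  by apply: contraTneq p1 => z1; have := prim_order_dvd z_prim 1;
    rewrite z1 expr1n eqxx dvdn1 => /eqP ->.
have rPhi : root (pQtoC Phi) z.
  have : (pQtoC (Phi * ('X - 1))).[z] = 0.
    by rewrite PhiX rmorphB /= map_polyXn rmorph1 hornerD hornerN hornerXn
      hornerC (prim_expr_order z_prim) subrr.
  rewrite rmorphM /= hornerM rmorphB /= map_polyX rmorph1 hornerD hornerX hornerN
    hornerC => /eqP.
  by rewrite mulf_eq0 subr_eq0 (negPf z1) orbF.
have qPhi : q %= Phi.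
  have qP : q %| Phi by rewrite -qdvd.
  by rewrite -(dvdp_size_eqp qP) sq sPhi.
have nA : ~~ (q %| A).
  apply/negP => qA; have A0 : A != 0 by apply: contraNneq Ai => ->; rewrite !coef0.
  have sqA : size A = p.
    by apply/anti_leq; rewrite sA -sq dvdp_leq.
  have : Phi %= A.
    have PA : Phi %| A by rewrite -(eqp_dvdl _ qPhi).
    by rewrite -(dvdp_size_eqp PA) sqA sPhi.
  case/eqpP => -[c1 c2] /= /andP [c10 c20] E; case/eqP: Ai.
  apply: (mulfI c20); rewrite -!coefZ -E !coefZ !coefPhi ip p0 //.
rewrite -(eqp_coprimepr _ qPhi) /coprimep.
have := dvdp_gcdr A q => /dvdpP [e Ee].
have q0 : q != 0 by exact: monic_neq0.
have /orP [qe|qg] : (q %| e) || (q %| gcdp A q).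
  by rewrite -!qdvd -rootM -rmorphM /= -Ee -mq root_minCpoly.
  have e0 : e != 0 by apply: contraNneq q0 => e0; rewrite Ee e0 mul0r.
  have g0 : gcdp A q != 0 by rewrite gcdp_eq0 (negPf q0) andbF.
  have se : (0 < size e)%N by rewrite size_poly_gt0.
  have sg : (0 < size (gcdp A q))%N by rewrite size_poly_gt0.
  have Es : size q = (size e + size (gcdp A q)).-1 by rewrite -size_mul // -Ee.
  have := dvdp_leq e0 qe; rewrite Es => le1.
  by apply/eqP; exact: sizes se sg le1.
by case/negP: nA; apply: dvdp_trans qg (dvdp_gcdl _ _).
Qed.

Section ShiftOperators.
Implicit Types (F H : {poly int}) (x : nat -> int).

(** The action of a polynomial in the shift on sequences: in terms of divisors,
    the orders of a product of integer powers of the conjugates of a function. *)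
Definition shift_op F x i : int := \sum_(l < size F) F`_l * x (i + l)%N.

Lemma shift_op_widen N F x i : (size F <= N)%N ->
  shift_op F x i = \sum_(l < N) F`_l * x (i + l)%N.
Proof.
move=> sN; rewrite /shift_op (big_ord_widen N (fun l => F`_l * x (i +
  l)%N) sN) big_mkcond /=.
apply: eq_bigr => l _; case: ltnP => // sl.
by rewrite nth_default // mul0r.
Qed.

Lemma shift_opD F H x i : shift_op (F + H) x i = shift_op F x i + shift_op H x i.
Proof.
pose N := maxn (size F) (size H).
rewrite !(@shift_op_widen N) ?leq_maxl ?leq_maxr //; last exact: size_polyD.
by rewrite -big_split; apply: eq_bigr => l _; rewrite coefD mulrDl.
Qed.

Lemma shift_opC c x i : shift_op c%:P x i = c * x i.
Proof.
rewrite (@shift_op_widen 1); last by rewrite size_polyC; case: (c == 0).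
by rewrite big_ord1 coefC /= addn0.
Qed.

Lemma shift_opMX F x i : shift_op (F * 'X) x i = shift_op F x i.+1.
Proof.
rewrite (@shift_op_widen (size F).+1); last by rewrite -[X in (_ <= X)%N]addn1
  (leq_trans (size_polyMleq _ _)) // size_polyX; lia.
rewrite big_ord_recl coefMX eqxx mul0r add0r; apply: eq_bigr => l _.
by rewrite coefMX /= /bump /= add1n addnS addSn.
Qed.

Lemma shift_opM F H x i : shift_op (F * H) x i = shift_op F (shift_op H x) i.
Proof.
elim/poly_ind: F i => [|F c IH] i.
  by rewrite mul0r -polyC0 !shift_opC !mul0r.
rewrite mulrDl shift_opD mulrAC shift_opMX IH [RHS]shift_opD shift_opMX
  shift_opC; congr (_ + _).
rewrite mul_polyC (@shift_op_widen (size H)) ?size_scale_leq // /shift_op mulr_sumr.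
by apply: eq_bigr => l _; rewrite coefZ mulrA.
Qed.

Lemma shift_op_ext F x x' i : x =1 x' -> shift_op F x i = shift_op F x' i.
Proof. by move=> E; apply: eq_bigr => l _; rewrite E. Qed.

Variables (p : nat) (p_prime : prime p).
Let delta i : int := (p %| i)%:R.

Lemma sum_delta i : \sum_(l < p) delta (i + l) = 1.
Proof.
have p0 := prime_gt0 p_prime; have l0p : ((p - i %% p) %% p < p)%N by rewrite
  ltn_mod.
have dl0 : (p %| i + (p - i %% p) %% p)%N.
  by rewrite /dvdn modnDmr -modnDml subnKC ?modnn // ltnW // ltn_mod.
rewrite (bigD1 (Ordinal l0p)) //= /delta dl0 big1 ?addr0 // => l.
rewrite -(inj_eq val_inj) /= => ll0; case E: (p %| i + l)%N => //.
case/eqP: ll0; rewrite -(modn_small (ltn_ord l)) -[RHS]modn_mod; apply/eqP.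
by rewrite -(eqn_modDl i) (eqP E) modnDmr -modnDmr (eqP dl0).
Qed.

(** The periodic sequence a is the image of the indicator of the multiples of p
    under a polynomial A in the shift.  Since a is not constant, A is invertible
    modulo 1 + X + ... + X^(p-1) over the rationals; this sum maps the indicator to
    the constant sequence 1, which every polynomial maps to a constant. *)
Lemma cyclic_inverse (a : nat -> int) : (forall i, a (i + p)%N = a i) ->
  (exists i, a i <> a 0%N) ->
  exists F (m : nat) (c : int), forall i, shift_op F a i =
    (m.+1)%:Z * (p %| i)%:R + c.
Proof.
move=> per [i0 ai0]; have p0 := prime_gt0 p_prime.
have amod i : a i = a (i %% p)%N.
  rewrite {1}(divn_eq i p); elim: (i %/ p)%N => [|d IH]; first by rewrite mul0n.
  by rewrite mulSn -addnA addnC per.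
(* The shift by l moves the indicator to the residue of - l, whence p - l. *)
pose A : {poly int} := \poly_(l < p) a (p - l)%N.
have Aa i : shift_op A delta i = a i.
  rewrite (@shift_op_widen p) ?size_poly // -[RHS]mulr1 -(sum_delta i) mulr_sumr.
  apply: eq_bigr => l _; rewrite coef_poly ltn_ord /delta.
  case E: (p %| i + l)%N; rewrite ?mulr0 // !mulr1 [LHS]amod [RHS]amod; congr a.
  apply/eqP; rewrite -(eqn_modDr l) (eqP E) subnK ?modnn //.
  exact: ltnW.
pose Phi : {poly int} := \sum_(i < p) 'X^i.
have coefPhi j : Phi`_j = (j < p)%:R := coef_sum_Xn _ p j.
have Phid i : shift_op Phi delta i = 1.
  rewrite (@shift_op_widen p); last by apply/leq_sizeP => j pj;
    rewrite coefPhi ltnNge pj.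
  by rewrite -(sum_delta i); apply: eq_bigr => l _; rewrite coefPhi ltn_ord mul1r.
pose toQ := map_poly (intr : int -> rat).
have cop : coprimep (toQ A) (\sum_(i < p) 'X^i).
  apply: prime_cyclotomic_coprime => //.
    by apply/leq_sizeP => j pj; rewrite coef_map coef_poly ltnNge pj.
  have m0 : (i0 %% p)%N != 0%N.
    by apply: contra_not_neq ai0 => m0; rewrite amod m0.
  exists (p - i0 %% p)%N; rewrite !coef_map !coef_poly p0 subn0.
  have ltm : (i0 %% p < p)%N by rewrite ltn_mod.
  rewrite ifT; last by lia.
  have ap : a p = a 0%N by rewrite -(per 0%N) add0n.
  rewrite ap subKn ?(ltnW ltm) // -amod eqr_int.
  by apply/andP; split; [lia|apply/eqP].
have toQPhi : toQ Phi = \sum_(i < p) 'X^i.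
  by rewrite /toQ rmorph_sum; apply: eq_bigr => l _; rewrite /= map_polyXn.
have /Bezout_coprimepP [[u v] /=] := cop; rewrite -toQPhi =>
  /eqpP [[c1 c2] /= /andP [c10 c20] E].
(* Clearing denominators in Bezout's identity. *)
have [uz [s s0 Eu]] := rat_poly_scale ((c1 / c2) *: u).
have [vz [t t0 Ev]] := rat_poly_scale ((c1 / c2) *: v).
have E1 : (c1 / c2) *: u * toQ A + (c1 / c2) *: v * toQ Phi = 1.
  rewrite -!scalerAl -scalerDr mulrC -scalerA E scalerA mulVf // scale1r //.
have sQ : s%:~R != 0 :> rat by rewrite intr_eq0.
have tQ : t%:~R != 0 :> rat by rewrite intr_eq0.
have Ez : (t *: uz) * A + (s *: vz) * Phi = (s * t)%:P.
  apply: (@map_inj_poly _ _ (intr : int -> rat)) => //; first exact: intr_inj.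
  rewrite rmorphD !rmorphM /= !map_polyZ !map_polyC /= -/(toQ _) -/(toQ Phi).
  rewrite -polyCM -[RHS]mulr1 -E1 Eu Ev mulrDr -/(toQ _) -/(toQ _).
  rewrite !mul_polyC -!scalerAl !scalerA; congr (_ *: _ + _ *: _).
    by rewrite mulrAC mulfV // mul1r.
  by rewrite mulfK.
(* The extra factor s t makes the constant (s t)^2 positive. *)
exists ((s * t) *: (t *: uz)), (`|s * t| ^ 2).-1.
exists (shift_op (- ((s * t) *: (s *: vz))) (fun=> 1) 0%N) => i.
have -> : shift_op ((s * t) *: (t *: uz)) a i =
    shift_op ((s * t) *: (t *: uz)) (shift_op A delta) i by apply: shift_op_ext
      => l; rewrite Aa.
rewrite -shift_opM (_ : _ * A = ((s * t) ^+ 2)%:P +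
  (- ((s * t) *: (s *: vz))) * Phi); last first.
  rewrite rmorphXn /= expr2 -{2}Ez -!mul_polyC; ring.
rewrite shift_opD shift_opC shift_opM; congr (_ + _); last first.
  by rewrite /shift_op; apply: eq_bigr => l _;
    rewrite -/(shift_op Phi delta (i + l)) Phid.
congr (_ * _); rewrite prednK ?expn_gt0 ?absz_gt0 ?mulf_neq0 // -abszX.
by rewrite gez0_abs // sqr_ge0.
Qed.
End ShiftOperators.

(** * Closed sets of projective space *)

Section Projective.
Variables (k : closedFieldType) (n : nat).
Implicit Types (x y : projspace k n) (Z : set (projspace k n)).

Lemma hcoord_neq0 x : exists i, hcoord x i != 0.
Proof.
apply: contrapT => H; have : vpick (sval x) == 0.
  apply/eqP/rowP => i; rewrite mxE; apply/eqP; apply: contrapT => /negP Hi.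
  by apply: H; exists i.
by rewrite vpick0 -dimv_eq0 (eqP (svalP x)).
Qed.

Lemma projspace_vline x : sval x = <[vpick (sval x)]>%VS.
Proof.
apply/esym/eqP; rewrite eqEdim (eqP (svalP x)) -memvE memv_pick dim_vline.
by rewrite vpick0 -dimv_eq0 (eqP (svalP x)).
Qed.

Lemma hcoord_inj x y c : (forall i, hcoord x i = c * hcoord y i) -> x = y.
Proof.
move=> H; apply: val_inj; rewrite /= projspace_vline [in RHS]projspace_vline.
have E : vpick (sval x) = c *: vpick (sval y).
  by apply/rowP => i; rewrite mxE; exact: H.
apply/eqP; rewrite eqEdim -memvE E memvZ ?memv_line //=.
by rewrite -E -!projspace_vline (eqP (svalP x)) (eqP (svalP y)).
Qed.

Lemma closed_proper_witness Z1 Z2 : zariski_closed Z1 -> ~ (Z2 `<=` Z1) ->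
  exists h d, [/\ h \is d.-homog, forall x, Z1 x -> heval h x = 0 &
    exists2 x, Z2 x & heval h x != 0].
Proof.
move=> [S [Sh ->]] /existsNP [x /not_implyP [Z2x /existsNP [h /not_implyP [Sh_
  hx]]]].
have [d dh] := Sh _ Sh_; exists h, d; split=> // [y|]; first exact.
by exists x => //; apply/eqP.
Qed.

Lemma zariski_closedU Z1 Z2 :
  zariski_closed Z1 -> zariski_closed Z2 -> zariski_closed (Z1 `|` Z2).
Proof.
move=> [S1 [h1 ->]] [S2 [h2 ->]].
exists [set g | exists f1 f2, [/\ S1 f1, S2 f2 & g = f1 * f2]]; split.
  move=> h [f1 [f2 [/h1 [d1 H1] /h2 [d2 H2] ->]]].
  by exists (d1 + d2)%N; apply: dhomogM.
rewrite eqEsubset; split=> x /=.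
  by move=> [] Hx h [f1 [f2 [S1f S2f ->]]]; rewrite /heval mevalM;
    [have := Hx _ S1f|have := Hx _ S2f]; rewrite /heval => ->;
      rewrite ?mul0r ?mulr0.
move=> H; have [H1|H1] := pselect (forall h, S1 h -> heval h x = 0);
  [by left|right].
move=> f2 S2f.
have [f1 /not_implyP [S1f f1x]] : exists f1, ~ (S1 f1 -> heval f1 x = 0).
  by apply/existsNP.
have /eqP := H (f1 * f2) (ex_intro _ f1 (ex_intro _ f2 (And3 S1f S2f erefl))).
by rewrite /heval mevalM mulf_eq0 => /orP [/eqP//|/eqP].
Qed.

Lemma zariski_closedI Z1 Z2 :
  zariski_closed Z1 -> zariski_closed Z2 -> zariski_closed (Z1 `&` Z2).
Proof.
move=> [S1 [h1 ->]] [S2 [h2 ->]]; exists (S1 `|` S2); split.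
  by move=> h [/h1|/h2].
rewrite eqEsubset; split=> x /=; first by move=> [H1 H2] h [/H1|/H2].
by move=> H; split=> h Sh; apply: H; [left|right].
Qed.

Lemma zariski_closed0 : zariski_closed (set0 : set (projspace k n)).
Proof.
exists [set 1]; split=> [h ->|]; first by exists 0%N; exact: dhomog1.
rewrite eqEsubset; split=> // x /= /(_ 1 erefl) /eqP.
by rewrite /heval meval1 oner_eq0.
Qed.

Lemma zariski_closed1 x : zariski_closed [set x].
Proof.
pose g i j : {mpoly k[n.+1]} := hcoord x j *: 'X_i - hcoord x i *: 'X_j.
exists [set h | exists i j, h = g i j]; split.
  move=> h [i [j ->]]; exists 1%N; apply: rpredB; apply: rpredZ;
  by rewrite dhomogX /= mdeg1.
rewrite eqEsubset; split=> y /=.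
  move=> -> h [i [j ->]]; rewrite /heval mevalB !mevalZ !mevalXU.
  by rewrite mulrC subrr.
move=> H; have [j xj] := hcoord_neq0 x.
apply: (@hcoord_inj y x (hcoord y j / hcoord x j)) => i.
have := H _ (ex_intro _ i (ex_intro _ j erefl)).
rewrite /heval mevalB !mevalZ !mevalXU => /eqP; rewrite subr_eq0 => /eqP E.
by apply: (mulfI xj); rewrite E; field.
Qed.

Lemma zariski_closed_finite Z : finite_set Z -> zariski_closed Z.
Proof.
move=> /finite_seqP [s ->]; elim: s => [|x s IH].
  rewrite (_ : [set` _] = set0); first exact: zariski_closed0.
  by rewrite eqEsubset; split.
rewrite (_ : [set` _] = [set x] `|` [set` s]).
  by apply: zariski_closedU => //; apply: zariski_closed1.
rewrite eqEsubset; split=> y /=; rewrite inE.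
  by case/orP => [/eqP|]; [left|right].
by case=> [->|->]; rewrite ?eqxx ?orbT.
Qed.

(** A strictly decreasing sequence of closed sets would give a sequence of
    polynomials, each vanishing on the next set but not on its own; by Hilbert's basis
    theorem one of them is a combination of the preceding ones, which all vanish on
    its set. *)
Lemma closed_minimal (P : set (projspace k n) -> Prop) Z :
  zariski_closed Z -> P Z ->
  exists Z0, [/\ zariski_closed Z0, P Z0, Z0 `<=` Z &
    forall Z', zariski_closed Z' -> P Z' -> Z' `<=` Z0 -> Z0 `<=` Z'].
Proof.
move=> Zc PZ; apply: contrapT => noZ.
pose T := {Z0 | [/\ zariski_closed Z0, P Z0 & Z0 `<=` Z]}.
have next (z : T) : exists z' : T, sval z' `<=` sval z /\ ~ (sval z `<=` sval z').
  case: z => Z0 [Z0c PZ0 Z0Z] /=; apply: contrapT => no; apply: noZ.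
  exists Z0; split=> // Z' Z'c PZ' Z'Z0; apply: contrapT => nsub; apply: no.
  by exists (exist _ Z' (And3 Z'c PZ' (fun x h => Z0Z x (Z'Z0 x h)))).
pose nx z := projT1 (cid (next z)).
have nxP z : sval (nx z) `<=` sval z /\ ~ (sval z `<=` sval (nx z)).
  exact: (projT2 (cid (next z))).
pose z0 : T := exist _ Z (And3 Zc PZ (fun _ => id)).
pose z i := iter i nx z0.
have zdec i j : (i <= j)%N -> sval (z j) `<=` sval (z i).
  move=> /subnK <-; elim: (j - i)%N => // d IH.
  by rewrite addSn; apply: subset_trans IH; exact: (nxP (z _)).1.
have wit i : exists h : {mpoly k[n.+1]},
   (forall x, sval (z i.+1) x -> heval h x = 0) /\
    exists2 x, sval (z i) x & heval h x != 0.
  have [zc _ _] := svalP (z i.+1).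
  by have [h [d [_ H1 H2]]] := closed_proper_witness zc (nxP (z i)).2; exists h.
pose f i := projT1 (cid (wit i)).
have fP i : (forall x, sval (z i.+1) x -> heval (f i) x = 0) /\
    exists2 x, sval (z i) x & heval (f i) x != 0.
  exact: (projT2 (cid (wit i))).
have [N [C fN]] := hilbert_basis f.
have [x zx] := (fP N).2; case/eqP; rewrite fN /heval raddf_sum /=.
rewrite big1 // => i _; rewrite mevalM.
have := (fP i).1 x; rewrite /heval => ->; first by rewrite mulr0.
by apply: zdec zx; exact: ltn_ord.
Qed.

End Projective.

(** A minimal infinite closed subset is irreducible, and a point of it would
    start a chain of length 2 that ends at Y. *)
Lemma proper_closed_finite (k : closedFieldType) n (Y Z : set (projspace k n)) :
  zariski_closed Y -> irreducible_set Y -> has_dimension Y 1 ->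
  zariski_closed Z -> Z `<=` Y -> ~ (Y `<=` Z) -> finite_set Z.
Proof.
move=> Yc Yirr [_ no2] Zc ZY YZ; apply: contrapT => Zinf; apply: no2.
have [Z0 [Z0c Z0inf Z0Z Z0min]] := closed_minimal (P :=
  fun A => infinite_set A) Zc Zinf.
have [q Z0q] : Z0 !=set0.
  by apply/set0P/eqP => Z00; apply: Z0inf; rewrite Z00; exact: finite_set0.
have irr1 : irreducible_set Z0.
  split; [by exists q|move=> Z1 Z2 Z1c Z2c Z12].
  have : infinite_set (Z0 `&` Z1) \/ infinite_set (Z0 `&` Z2).
    have [/contrapT f1|f1] := pselect (~ infinite_set (Z0 `&` Z1));
      [right=> f2|by left; apply: contrapT].
    apply: Z0inf; apply: (@sub_finite_set _ _ ((Z0 `&` Z1) `|` (Z0 `&` Z2))).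
      by rewrite -setIUr => x Z0x; split=> //; exact: Z12.
    by rewrite finite_setU.
  case=> /Z0min H; [left|right]; (apply: subset_trans (H _ _) _;
    [exact: zariski_closedI|by move=> x []|by move=> x []]).
exists (fun i => if i == 0%N then [set q] else if i == 1%N then Z0 else Y); split.
  case=> [|[|[|]]] //= _; split=> //.
  - exact: zariski_closed1.
  - split; [by exists q|move=> Z1 Z2 _ _ /(_ q erefl)].
    by case=> H; [left|right] => x ->.
  - by move=> x ->; apply: ZY; apply: Z0Z.
  - exact: subset_trans Z0Z ZY.
case=> [|[|]] //= _; split.
- by move=> x ->.
- by move=> E; apply: Z0inf; rewrite -E; exact: finite_set1.
- exact: subset_trans Z0Z ZY.
- by move=> E; apply: YZ; rewrite -E.
Qed.

(** A finite irreducible set is a point, which contains no chain of length 1. *)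
Lemma curve_infinite (k : closedFieldType) n (Y : set (projspace k n)) :
  irreducible_set Y -> has_dimension Y 1 -> infinite_set Y.
Proof.
move=> Yirr [[C [C1 C2]] _] Yfin.
have [C01 C01n] := C2 0%N isT.
have [_ [[q C0q] _] _] := C1 0%N isT; have [_ _ C1Y] := C1 1%N isT.
have Yqc : zariski_closed (Y `\ q).
  by apply: zariski_closed_finite; apply: sub_finite_set Yfin => x [].
have Ycov : Y `<=` [set q] `|` (Y `\ q).
  by move=> y Yy; case: (pselect (y = q)) => yq; [left|right].
case: (Yirr.2 _ _ (zariski_closed1 q) Yqc Ycov) => [Yq|].
  apply: C01n; rewrite eqEsubset; split=> // x /C1Y /Yq ->; exact: C0q.
by case/(_ q (C1Y _ (C01 _ C0q))) => _; apply.
Qed.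

(** * Local rings of a curve *)

(** Polynomials are generated as a ring by constants and variables; this form
    suits properties stable under sums and products, such as regularity. *)
Lemma mpoly_ring_ind (R : comNzRingType) n (P : {mpoly R[n]} -> Prop) :
  (forall c, P c%:MP) -> (forall i, P 'X_i) ->
  (forall p q, P p -> P q -> P (p + q)) ->
  (forall p q, P p -> P q -> P (p * q)) -> forall p, P p.
Proof.
move=> PC PX PD PM; elim/mpolyind; first exact: (PC 0).
move=> c m p _ _ Pp; apply: PD => //; rewrite -mul_mpolyC; apply: (PM) => //.
rewrite mpolyXE_id; apply: (big_ind P) => [||i _]; [exact: (PC 1)|exact: PM|].
by elim: (m i) => [|d IH]; rewrite ?expr0 ?exprS; [exact: (PC 1)|exact: PM].
Qed.

Lemma dhomog_mevalZ (R : comNzRingType) n d (p : {mpoly R[n]}) (c : R) v :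
  p \is d.-homog -> p.@[fun i => c * v i] = c ^+ d * p.@[v].
Proof.
move=> /dhomogP ph; rewrite !mevalE mulr_sumr big_seq [RHS]big_seq.
apply: eq_bigr => m /ph dm; rewrite mulrCA; congr (_ * _).
have -> : d = (\sum_i m i)%N by rewrite -[LHS]dm /= mdegE.
rewrite expr_sum -big_split /=.
by apply: eq_bigr => i _; rewrite exprMn.
Qed.

(** As a class, the hypothesis on the curve is an implicit argument that is
    resolved from the context. *)
Existing Class nonsingular_projective_curve.

Section Curve.
Variables (k : closedFieldType) (n : nat) (Y : set (projspace k n)).
Context {Y_curve : nonsingular_projective_curve Y}.
Implicit Types (U V : set Y) (x y : Y) (f g u : Y -> k) (a b : {mpoly k[n.+1]}).

(** The nonempty open subsets of a curve are the cofinite ones, so generic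
    properties and Zariski neighbourhoods are both handled by finiteness. *)
Definition generic (P : Y -> Prop) := finite_set [set y | ~ P y].

Lemma generic_mono2 (P Q R : Y -> Prop) :
  generic P -> generic Q -> (forall y, P y -> Q y -> R y) -> generic R.
Proof.
move=> gP gQ PQR.
apply: (@sub_finite_set _ _ ([set y | ~ P y] `|` [set y | ~ Q y])); last first.
  by rewrite finite_setU.
move=> y nR; have [Py|] := pselect (P y); last by left.
by right=> Qy; apply: nR; apply: PQR.
Qed.

Lemma generic_all (P : Y -> Prop) : (forall y, P y) -> generic P.
Proof.
move=> HP; apply: (@sub_finite_set _ _ set0); last exact: finite_set0.
by move=> y /= []; apply: HP.
Qed.

Lemma generic_mono (P R : Y -> Prop) : generic P -> (forall y, P y -> R y) ->
  generic R.
Proof. by move=> gP PR; apply: (generic_mono2 gP gP) => y /PR. Qed.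

Lemma generic_mono3 (P Q S R : Y -> Prop) :
  generic P -> generic Q -> generic S -> (forall y, P y -> Q y -> S y -> R y) ->
    generic R.
Proof.
move=> gP gQ gS H; apply: (generic_mono2 (generic_mono2 gP gQ (fun y =>
  @conj _ _)) gS).
by move=> y [Py Qy] Sy; apply: H.
Qed.

Lemma generic_mono4 (P Q S T R : Y -> Prop) : generic P -> generic Q ->
  generic S -> generic T ->
  (forall y, P y -> Q y -> S y -> T y -> R y) -> generic R.
Proof.
move=> gP gQ gS gT H; apply: (generic_mono3 (generic_mono2 gP gQ (fun y =>
  @conj _ _)) gS gT).
by move=> y [Py Qy] Sy Ty; apply: H.
Qed.

Lemma generic_neq x : generic (fun y => y <> x).
Proof.
apply: (@sub_finite_set _ _ [set x]); last exact: finite_set1.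
by move=> y /= /contrapT.
Qed.

Lemma generic_forall m (P : 'I_m -> Y -> Prop) :
  (forall i, generic (P i)) -> generic (fun y => forall i, P i y).
Proof.
move=> gP; apply: (@sub_finite_set _ _ (\bigcup_(i in [set: 'I_m]) [set y | ~ P i
  y])).
  by move=> y /= /existsNP [i Pi]; exists i.
by apply: bigcup_finite => // i _; apply: gP.
Qed.

Lemma points_infinite : infinite_set [set: Y].
Proof.
have [Yc Yirr Ydim _] := Y_curve.
move=> Yfin; apply: (curve_infinite Yirr Ydim).
apply: (@sub_finite_set _ _ ((fun y : Y => val y) @` [set: Y])).
  move=> z Yz; exists (SigSub (mem_set Yz)) => //.
exact: finite_image.
Qed.

Lemma generic_ex P : generic P -> exists y, P y.
Proof.
move=> gP; apply: contrapT => noP; apply: points_infinite.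
by apply: sub_finite_set gP => y _ Py; apply: noP; exists y.
Qed.

Lemma open_generic U x : zariski_open U -> U x -> generic U.
Proof.
have [Yc Yirr Ydim _] := Y_curve.
move=> [Z [Zc ->]] Ux; rewrite /generic.
have fin : finite_set (Z `&` Y).
  have ZYc : zariski_closed (Z `&` Y) by exact: zariski_closedI.
  apply: (proper_closed_finite Yc Yirr Ydim ZYc) => [z [] //|].
  by move=> /(_ (val x) (set_mem (valP x))) [].
apply: (@sub_finite_set _ _ ((fun y : Y => val y) @^-1` (Z `&` Y))); last first.
  by apply: finite_preimage fin => y z _ _; exact: val_inj.
move=> y /= /contrapT Zy; split=> //.
exact: set_mem (valP y).
Qed.

Lemma generic_open P : generic P -> zariski_open [set y | P y].
Proof.
move=> gP; exists ((fun y : Y => val y) @` [set y | ~ P y]); split.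
  by apply: zariski_closed_finite; apply: finite_image.
rewrite eqEsubset; split=> y /=; last by move=> H; apply: contrapT => nP;
  apply: H; exists y.
by move=> Py [z nPz /val_inj zy]; apply: nPz; rewrite zy.
Qed.

Lemma openP U x : (zariski_open U /\ U x) <-> (generic U /\ U x).
Proof.
split=> -[H Ux]; split=> //; first exact: open_generic Ux.
by have := generic_open H.
Qed.

(** Membership in the local ring at x.  As nonempty open sets are cofinite, a
    condition near x splits into the condition at x and a generic condition. *)
Definition reg x f := exists d a b,
  [/\ a \is d.-homog, b \is d.-homog,
      heval b (val x) != 0, f x = heval a (val x) / heval b (val x) &
      generic (fun y => f y = heval a (val y) / heval b (val y))].

Lemma heval_neq0_generic d b x : b \is d.-homog -> heval b (val x) != 0 ->
  generic (fun y => heval b (val y) != 0).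
Proof.
move=> bh bx; apply: (@open_generic [set y | heval b (val y) != 0] x) => //.
exists [set z | heval b z = 0]; split.
  exists [set b]; split=> [h ->|]; first by exists d.
  by rewrite eqEsubset; split=> z /= H; [move=> h ->|apply: H].
by rewrite eqEsubset; split=> z /= /eqP.
Qed.

Lemma regP x f : regular_at x f <-> reg x f.
Proof.
split=> [[U [Uo Ux /(_ x Ux) [V [d [a [b [Vo Vx ah bh H]]]]]]]|].
  exists d, a, b; have [bx fx] := H x Ux Vx; split=> //.
  by apply: (generic_mono2 (open_generic Uo Ux) (open_generic Vo Vx)) => y Uy Vy;
    case: (H y Uy Vy).
move=> [d [a [b [ah bh bx fx gf]]]].
pose U := [set y | y = x \/ (heval b (val y) != 0 /\
  f y = heval a (val y) / heval b (val y))].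
have Uo : zariski_open U.
  apply: generic_open; apply: (generic_mono2 gf (heval_neq0_generic bh bx)) => y;
    by right.
exists U; split=> //; first by left.
move=> y Uy; exists U, d, a, b; split=> // z Uz _.
by case: Uz => [->|].
Qed.

Lemma regular_reg U f : zariski_open U ->
  (forall x, U x -> reg x f) -> regular U f.
Proof.
move=> Uo H x Ux; have /regP [V [Vo Vx rV]] := H x Ux.
have [W [d [a [b [Wo Wx ah bh Hab]]]]] := rV x Vx.
have [VWo VWx] : zariski_open (V `&` W) /\ (V `&` W) x.
  apply/openP; split=> //; apply: (generic_mono2 (open_generic Vo Vx)
    (open_generic Wo Wx)).
  by move=> y; split.
by exists (V `&` W), d, a, b; split=> // y Uy [Vy Wy]; apply: Hab.
Qed.

Lemma reg_regular U f x : zariski_open U -> regular U f -> U x -> reg x f.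
Proof. by move=> Uo rf Ux; apply/regP; exists U. Qed.

Lemma reg_generic x f : reg x f -> generic (fun y => reg y f).
Proof.
move=> /regP [U [Uo Ux rU]]; apply: (generic_mono (open_generic Uo Ux)) => y Uy.
exact: reg_regular rU Uy.
Qed.

Lemma reg_ext x f g : reg x f -> f x = g x -> generic (fun y => f y = g y) ->
  reg x g.
Proof.
move=> [d [a [b [ah bh bx fx gf]]]] fgx gfg.
exists d, a, b; split=> //; first by rewrite -fgx.
by apply: (generic_mono2 gfg gf) => y <-.
Qed.

Lemma near_eqP x f g : near_eq x f g <-> f x = g x /\ generic (fun y => f y = g y).
Proof.
split=> [[U [Uo Ux H]]|[fgx gfg]].
  by split; [exact: H|apply: (generic_mono (open_generic Uo Ux))].
by exists [set y | f y = g y]; split=> //; apply: generic_open.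
Qed.

Lemma homog_zero_generic d a x : a \is d.-homog ->
  generic (fun y => heval a (val y) = 0) -> heval a (val x) = 0.
Proof.
move=> ah ga; apply/eqP; apply: contrapT => /negP ax.
have [y [/eqP]] : exists y, heval a (val y) != 0 /\ heval a (val y) = 0.
  by apply: generic_ex; apply: (generic_mono2 (heval_neq0_generic ah ax) ga).
by [].
Qed.

(** The difference of the cross products is a form that vanishes at all but
    finitely many points of Y, hence at all points. *)
Lemma reg_eq_generic x f g : reg x f -> reg x g ->
  generic (fun y => f y = g y) -> f x = g x.
Proof.
move=> [d [a [b [ah bh bx -> gf]]]] [d' [a' [b' [ah' bh' bx' -> gg]]]] gfg.
have : heval (a * b' - a' * b) (val x) = 0.
  apply: (@homog_zero_generic (d + d')%N).
    by apply: rpredB; [|rewrite addnC]; apply: dhomogM.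
  apply: (generic_mono4 gf gg gfg (generic_mono2 (heval_neq0_generic bh bx)
    (heval_neq0_generic bh' bx') (fun y => @conj _ _))).
  move=> y fy gy; rewrite fy gy => E [by0 by'0]; rewrite /heval mevalB !mevalM.
  rewrite -/(heval _ _) in E *; apply/eqP; rewrite subr_eq0; apply/eqP.
  by move/eqP: E; rewrite eqr_div // => /eqP.
rewrite /heval mevalB !mevalM => /eqP; rewrite subr_eq0 => /eqP E.
by apply/eqP; rewrite eqr_div //; apply/eqP.
Qed.

Lemma reg_cst c x : reg x (fun=> c).
Proof.
exists 0%N, c%:MP, 1; split; rewrite /heval ?meval1 ?mevalC ?divr1 ?oner_eq0 //.
- by rewrite -[c%:MP]mulr1 mul_mpolyC; apply: rpredZ; exact: dhomog1.
- exact: dhomog1.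
by apply: generic_all => y; rewrite mevalC meval1 divr1.
Qed.

Lemma regD x f g : reg x f -> reg x g -> reg x (fun y => f y + g y).
Proof.
move=> [d [a [b [ah bh bx fx gf]]]] [d' [a' [b' [ah' bh' bx' gx gg]]]].
have bbx : heval (b * b') (val x) != 0 by rewrite /heval mevalM mulf_neq0.
exists (d + d')%N, (a * b' + a' * b), (b * b'); split=> //.
- by apply: rpredD; [|rewrite addnC]; apply: dhomogM.
- exact: dhomogM.
- by rewrite fx gx /heval mevalD !mevalM addf_div.
apply: (generic_mono4 gf gg (heval_neq0_generic bh bx) (heval_neq0_generic bh'
  bx')) => y -> -> ? ?.
by rewrite /heval mevalD !mevalM addf_div.
Qed.

Lemma regM x f g : reg x f -> reg x g -> reg x (fun y => f y * g y).
Proof.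
move=> [d [a [b [ah bh bx fx gf]]]] [d' [a' [b' [ah' bh' bx' gx gg]]]].
have bbx : heval (b * b') (val x) != 0 by rewrite /heval mevalM mulf_neq0.
exists (d + d')%N, (a * a'), (b * b'); split; rewrite ?dhomogM //.
- by rewrite fx gx /heval !mevalM mulf_div.
apply: (generic_mono2 gf gg) => y -> ->.
by rewrite /heval !mevalM mulf_div.
Qed.

Lemma regV x f : reg x f -> f x != 0 -> reg x (fun y => (f y)^-1).
Proof.
move=> [d [a [b [ah bh bx fx gf]]]] fx0.
exists d, b, a; split=> //.
- by apply: contraNneq fx0 => ax; rewrite fx ax mul0r.
- by rewrite fx invf_div.
by apply: (generic_mono gf) => y ->; rewrite invf_div.
Qed.

Lemma regZ x c f : reg x f -> reg x (fun y => c * f y).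
Proof. by move=> rf; apply: regM => //; exact: reg_cst. Qed.

Lemma regN x f : reg x f -> reg x (fun y => - f y).
Proof.
move=> rf; apply: (reg_ext (regZ (-1) rf)); first by rewrite mulN1r.
by apply: generic_all => y; rewrite mulN1r.
Qed.

Lemma regB x f g : reg x f -> reg x g -> reg x (fun y => f y - g y).
Proof. by move=> rf rg; apply: (regD rf (regN rg)). Qed.

Lemma regX x f m : reg x f -> reg x (fun y => f y ^+ m).
Proof.
move=> rf; elim: m => [|m IH]; first exact: reg_cst.
apply: (reg_ext (regM rf IH)); first by rewrite exprS.
by apply: generic_all => y; rewrite exprS.
Qed.

Lemma reg_sum x (I : Type) (r : seq I) (P : pred I) (F : I -> Y -> k) :
  (forall i, reg x (F i)) -> reg x (fun y => \sum_(i <- r | P i) F i y).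
Proof.
move=> rF; have -> : (fun y => \sum_(i <- r | P i) F i y) = \sum_(i <- r | P i) F i.
  by apply/funext => y; rewrite fct_sumE.
elim/big_ind: _ => [|f g rf rg|i _] //; [exact: reg_cst|exact: regD].
Qed.

Lemma reg_prod x (I : Type) (r : seq I) (P : pred I) (F : I -> Y -> k) :
  (forall i, reg x (F i)) -> reg x (fun y => \prod_(i <- r | P i) F i y).
Proof.
move=> rF; elim: r => [|i r IH].
  by apply: (reg_ext (reg_cst 1 x)); rewrite ?big_nil //;
    apply: generic_all => y; rewrite big_nil.
case Pi: (P i).
  apply: (reg_ext (regM (rF i) IH)); first by rewrite big_cons Pi.
  by apply: generic_all => y; rewrite big_cons Pi.
by apply: (reg_ext IH); [rewrite big_cons Pi|apply: generic_all => y;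
  rewrite big_cons Pi].
Qed.

(** The zeros of the numerator form a closed subset of Y. *)
Lemma reg_zero_or_neq0 x f : reg x f -> generic (fun y => f y = 0) \/
  generic (fun y => f y != 0).
Proof.
move=> [d [a [b [ah bh bx _ gf]]]].
have [a0|] := pselect (forall y, heval a (val y) = 0).
  by left; apply: (generic_mono gf) => y ->; rewrite a0 mul0r.
move=> /existsNP [y /eqP ay]; right.
apply: (generic_mono3 gf (heval_neq0_generic ah ay) (heval_neq0_generic bh bx))
  => z -> az bz.
by rewrite mulf_neq0 // invr_eq0.
Qed.

Lemma reg_neq0_generic x f : reg x f -> f x != 0 -> generic (fun y => f y != 0).
Proof.
move=> rf fx; case: (reg_zero_or_neq0 rf) => // f0; case/eqP: fx.
by apply: (reg_eq_generic rf (reg_cst 0 x)).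
Qed.

Definition chart x : 'I_n.+1 := projT1 (cid (hcoord_neq0 (val x))).
(** Affine coordinates on the chart where the coordinate chosen at x does not
    vanish; they turn germs of regular functions into fractions of polynomials which
    need not be homogeneous. *)
Definition affine x y : 'I_n.+1 -> k := fun j =>
  (hcoord (val y) (chart x))^-1 * hcoord (val y) j.

Lemma chart_neq0 x : hcoord (val x) (chart x) != 0.
Proof. exact: (projT2 (cid (hcoord_neq0 (val x)))). Qed.

Lemma heval_affine d a x y : a \is d.-homog -> 
  a.@[affine x y] = (hcoord (val y) (chart x))^-1 ^+ d * heval a (val y).
Proof. exact: dhomog_mevalZ. Qed.

Lemma heval_X i y : heval 'X_i (val y) = hcoord (val y) i.
Proof. exact: mevalXU. Qed.

Lemma homogX i : ('X_i : {mpoly k[n.+1]}) \is 1.-homog.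
Proof. by rewrite dhomogX /= mdeg1. Qed.

Lemma reg_affineX x j : reg x (fun y => affine x y j).
Proof.
exists 1%N, 'X_j, 'X_(chart x); rewrite !homogX; split=> //.
- by rewrite heval_X chart_neq0.
- by rewrite !heval_X mulrC.
by apply: generic_all => y; rewrite !heval_X mulrC.
Qed.

Lemma reg_affine x p : reg x (fun y => p.@[affine x y]).
Proof.
elim/mpoly_ring_ind: p => [c|i|p q rp rq|p q rp rq].
- by under eq_fun do rewrite mevalC; exact: reg_cst.
- by under eq_fun do rewrite mevalXU; exact: reg_affineX.
- by under eq_fun do rewrite mevalD; exact: regD.
- by under eq_fun do rewrite mevalM; exact: regM.
Qed.

Lemma chart_generic x : generic (fun y => hcoord (val y) (chart x) != 0).
Proof.
have := @heval_neq0_generic 1 'X_(chart x) x (homogX _).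
rewrite heval_X => /(_ (chart_neq0 x)) H.
by apply: (generic_mono H) => y; rewrite heval_X.
Qed.

Lemma reg_affine_at x y j : hcoord (val y) (chart x) != 0 ->
  reg y (fun z => affine x z j).
Proof.
move=> y0; exists 1%N, 'X_j, 'X_(chart x); rewrite !homogX; split=> //.
- by rewrite heval_X.
- by rewrite !heval_X mulrC.
by apply: generic_all => z; rewrite !heval_X mulrC.
Qed.

Lemma reg_affine_atP x y f : hcoord (val y) (chart x) != 0 -> reg y f ->
  exists p q, [/\ q.@[affine x y] != 0, f y * q.@[affine x y] = p.@[affine x y] &
  generic (fun z => f z * q.@[affine x z] = p.@[affine x z])].
Proof.
move=> y0 [d [a [b [ah bh bx fx gf]]]].
have E z : hcoord (val z) (chart x) != 0 -> heval b (val z) != 0 ->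
    heval a (val z) / heval b (val z) * b.@[affine x z] = a.@[affine x z].
  by move=> z0 bz; rewrite (heval_affine x z ah) (heval_affine x z bh); field.
exists a, b; split.
- by rewrite (heval_affine _ _ bh) mulf_neq0 // expf_neq0 // invr_eq0.
- by rewrite fx E.
by apply: (generic_mono3 gf (chart_generic x) (heval_neq0_generic bh bx)) => z ->
  z0 bz; rewrite E.
Qed.

(** A quotient of a form that vanishes at x but not at y by a power of a linear
    form that vanishes at neither. *)
Lemma reg_separate x y : x <> y ->
  exists f, [/\ reg x f, reg y f, f x = 0 & f y != 0].
Proof.
move=> xy.
have nsub : ~ ([set val y] `<=` [set val x]).
  by move=> /(_ (val y) erefl) /= E; apply: xy; apply: val_inj.
have [h [d [hh hx [_ -> hy]]]] := closed_proper_witness (zariski_closed1 (val x))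
  nsub.
have [l [lh lx ly]] : exists l, [/\ l \is 1.-homog,
  heval l (val x) != 0 & heval l (val y) != 0].
  have X i : 'X_i \is 1.-homog := homogX i.
  have [cx|] := eqVneq (heval 'X_(chart y) (val x)) 0; last first.
    by move=> H; exists 'X_(chart y); split=> //; rewrite heval_X chart_neq0.
  have [cy|] := eqVneq (heval 'X_(chart x) (val y)) 0; last first.
    by move=> H; exists 'X_(chart x); split=> //; rewrite heval_X chart_neq0.
  exists ('X_(chart x) + 'X_(chart y)); split; first exact: rpredD.
    by rewrite /heval mevalD -!/(heval _ _) cx addr0 heval_X chart_neq0.
  by rewrite /heval mevalD -!/(heval _ _) cy add0r heval_X chart_neq0.
have ldh : l ^+ d \is d.-homog by have := dhomogMn d lh; rewrite mul1n.
have ldE z : heval (l ^+ d) z = heval l z ^+ d by rewrite /heval rmorphXn.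
exists (fun z : Y => heval h (val z) / heval (l ^+ d) (val z)); split.
- exists d, h, (l ^+ d); split=> //; first by rewrite ldE expf_neq0.
  exact: generic_all.
- exists d, h, (l ^+ d); split=> //; first by rewrite ldE expf_neq0.
  exact: generic_all.
- by rewrite hx ?mul0r.
- by rewrite ldE mulf_neq0 // invr_eq0 expf_neq0.
Qed.

End Curve.

(** * Orders of vanishing *)

Section Orders.
Variables (k : closedFieldType) (n : nat) (Y : set (projspace k n)).
Context {Y_curve : nonsingular_projective_curve Y}.
Implicit Types (U V : set Y) (x y : Y) (f g u : Y -> k).
Implicit Types (i j : int).

Definition uniformizer x t := [/\ reg x t, t x = 0 &
  forall f, reg x f -> f x = 0 -> exists a, reg x a /\
    generic (fun y => f y = t y * a y)].

Lemma uniformizer_ex x : exists t, uniformizer x t.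
Proof.
have [_ _ _ /(_ x) [t [translate tgen]]] := Y_curve.
have [/regP r0 t0] := translate ord0.
exists (t ord0); split=> // f /regP rf fx.
have [a [ra /near_eqP [_ E]]] := tgen f rf fx.
exists (a ord0); split; first by apply/regP.
by apply: (generic_mono E) => y ->; rewrite big_ord1 mulrC.
Qed.

Definition param x : Y -> k := projT1 (cid (uniformizer_ex x)).

Lemma param_uniformizer x : uniformizer x (param x).
Proof. exact: (projT2 (cid (uniformizer_ex x))). Qed.

Lemma reg_param x : reg x (param x).
Proof. by have [] := param_uniformizer x. Qed.
Lemma param0 x : param x x = 0.
Proof. by have [] := param_uniformizer x. Qed.
Lemma param_dvd x f : reg x f -> f x = 0 ->
  exists a, reg x a /\ generic (fun y => f y = param x y * a y).
Proof. by case: (param_uniformizer x) => _ _; apply. Qed.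

(** If the parameter were generically zero, so would be every function that
    vanishes at x, against the separation of points. *)
Lemma param_neq0 x : generic (fun y => param x y != 0).
Proof.
case: (reg_zero_or_neq0 (reg_param x)) => // pr00; exfalso.
have [y /nesym xy] := generic_ex (generic_neq x).
have [f [rx ry fx /eqP []]] := reg_separate xy.
have [a [ra E]] := param_dvd rx fx.
apply: (reg_eq_generic ry (reg_cst 0 y)).
by apply: (generic_mono2 E pr00) => z -> ->; rewrite mul0r.
Qed.

(** Write f = t^m g_m and g_m = P_m / Q_m.  Some P_N is a combination of the
    preceding P_i, and g_i = t^(N - i) g_N for i < N; so g_N is multiplied to zero by
    Q_N minus a multiple of t, which does not vanish at x. *)
Lemma krull x f :
  (forall m, exists g, reg x g /\ generic (fun y => f y = param x y ^+ m * g y)) ->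
  generic (fun y => f y = 0).
Proof.
move=> H; pose g m := projT1 (cid (H m)).
have gP m : reg x (g m) /\ generic (fun y => f y = param x y ^+ m * g m y).
  exact: (projT2 (cid (H m))).
have pq m : exists pq : {mpoly k[n.+1]} * {mpoly k[n.+1]}, 
   pq.2.@[affine x x] != 0 /\ generic (fun y => pq.2.@[affine x y] != 0 /\
     g m y * pq.2.@[affine x y] = pq.1.@[affine x y]).
  have [p [q [qx _ gg]]] := reg_affine_atP (chart_neq0 x) (gP m).1.
  exists (p, q); split=> //=.
  by apply: (generic_mono2 gg (reg_neq0_generic (reg_affine x q) qx)); split.
pose P m := (projT1 (cid (pq m))).1; pose Q m := (projT1 (cid (pq m))).2.
have PQ m : (Q m).@[affine x x] != 0 /\
    generic (fun y => (Q m).@[affine x y] != 0 /\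
      g m y * (Q m).@[affine x y] = (P m).@[affine x y]).
  exact: (projT2 (cid (pq m))).
have [N [C PN]] := hilbert_basis P.
(* The product g_N w is generically zero although w does not vanish at x. *)
pose w y := (Q N).@[affine x y] -
  \sum_(i < N) (C i).@[affine x y] * (param x y ^+ (N - i) * (Q i).@[affine x y]).
have rw : reg x w.
  apply: regB; first exact: reg_affine.
  apply: reg_sum => i; apply: regM; first exact: reg_affine.
  apply: regM; last exact: reg_affine.
  by apply: regX => //; exact: reg_param.
have wx : w x != 0.
  rewrite /w big1 ?subr0; first by case: (PQ N).
  by move=> i _; rewrite param0 expr0n subn_eq0 leqNgt ltn_ord mul0r mulr0.
have gall := generic_forall (fun i : 'I_N =>
  generic_mono2 (gP i).2 (PQ i).2 (fun y => @conj _ _)).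
apply: (generic_mono4 (generic_mono2 (gP N).2 (PQ N).2 (fun y =>
  @conj _ _)) gall (param_neq0 x) (reg_neq0_generic rw wx)).
move=> y [fN [_ EN]] all t0 wy.
suff gN0 : g N y * w y = 0.
  by move/eqP: gN0; rewrite mulf_eq0 (negPf wy) orbF fN => /eqP ->; rewrite mulr0.
rewrite /w mulrBr EN PN raddf_sum mulr_sumr -sumrB big1 //= => i _.
have [fi [_ Ei]] := all i.
have gi : g i y = param x y ^+ (N - i) * g N y.
  apply: (mulfI (expf_neq0 i t0)); rewrite -fi fN mulrA -exprD subnKC //.
  exact: ltnW (ltn_ord i).
by rewrite mevalM -Ei gi; ring.
Qed.

Lemma reg_fact x f : reg x f -> generic (fun y => f y = 0) \/
  exists m u, [/\ reg x u, u x != 0 & generic (fun y => f y =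
    param x y ^+ m * u y)].
Proof.
move=> rf.
have [/krull|] := pselect (forall m, exists g, reg x g /\
  generic (fun y => f y = param x y ^+ m * g y)).
  by left.
move=> /existsNP H; right.
have ex : exists m, ~~ `[< exists g, reg x g /\
  generic (fun y => f y = param x y ^+ m * g y) >].
  by case: H => m Hm; exists m; apply/asboolP.
case: (ex_minnP ex) => -[|m] /asboolP Hm mmin.
  by case: Hm; exists f; split=> //; apply: generic_all => y; rewrite expr0 mul1r.
have [g [rg gg]] : exists g, reg x g /\ generic (fun y => f y =
  param x y ^+ m * g y).
  by apply/asboolP; apply: contraT => /mmin; rewrite ltnn.
exists m, g; split=> //; apply/eqP => gx; apply: Hm.
have [a [ra ga]] := param_dvd rg gx; exists a; split=> //.
by apply: (generic_mono2 gg ga) => y -> ->; rewrite exprS; ring.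
Qed.

(** The order of a rational function at x; rational functions are represented
    by plain functions up to generic equality. *)
Definition has_order x f i :=
  exists u, [/\ reg x u, u x != 0 & generic (fun y => f y = param x y ^ i * u y)].
(** Regularity at x up to the values at finitely many points, x included. *)
Definition extends_at x f := exists u, reg x u /\ generic (fun y => f y = u y).
Definition order_ge x i f := extends_at x (fun y => param x y ^ (- i) * f y).
Definition rational f := exists x, extends_at x f.

Lemma reg_extends x f : reg x f -> extends_at x f.
Proof. by move=> rf; exists f; split=> //; exact: generic_all. Qed.

Lemma extends_at_ext x f g : generic (fun y => f y = g y) -> extends_at x f ->
  extends_at x g.
Proof. by move=> fg [u [ru fu]]; exists u; split=> //;
  apply: (generic_mono2 fg fu) => y <-. Qed.

Lemma extends_atD x f g : extends_at x f -> extends_at x g ->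
  extends_at x (fun y => f y + g y).
Proof.
move=> [u [ru fu]] [v [rv gv]]; exists (fun y => u y + v y); split.
  exact: regD.
by apply: (generic_mono2 fu gv) => y -> ->.
Qed.

Lemma extends_atM x f g : extends_at x f -> extends_at x g ->
  extends_at x (fun y => f y * g y).
Proof.
move=> [u [ru fu]] [v [rv gv]]; exists (fun y => u y * v y); split.
  exact: regM.
by apply: (generic_mono2 fu gv) => y -> ->.
Qed.

Lemma extends_at_cst x c : extends_at x (fun=> c).
Proof. by apply: reg_extends; exact: reg_cst. Qed.

Lemma extends_at_reg_generic x f : extends_at x f -> generic (fun y => reg y f).
Proof.
move=> [u [ru fu]]; apply: (generic_mono2 (reg_generic ru) fu) => y ryu E.
by apply: (reg_ext ryu) => //; apply: (generic_mono fu).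
Qed.

Lemma rational_reg_generic f : rational f -> generic (fun y => reg y f).
Proof. by move=> [x]; exact: extends_at_reg_generic. Qed.

Lemma has_order_ext x f g i : generic (fun y => f y = g y) -> has_order x f i ->
  has_order x g i.
Proof.
move=> fg [u [ru ux fu]]; exists u; split=> //.
by apply: (generic_mono2 fg fu) => y <-.
Qed.

Lemma has_orderM x f g i j : has_order x f i -> has_order x g j ->
  has_order x (fun y => f y * g y) (i + j).
Proof.
move=> [u [ru ux fu]] [v [rv vx gv]]; exists (fun y => u y * v y); split.
- exact: regM.
- exact: mulf_neq0.
by apply: (generic_mono3 fu gv (param_neq0 x)) => y -> -> t0; rewrite expfzDr //;
  ring.
Qed.

Lemma has_orderV x f i : has_order x f i -> has_order x (fun y => (f y)^-1) (- i).
Proof.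
move=> [u [ru ux fu]]; exists (fun y => (u y)^-1); split.
- exact: regV.
- by rewrite invr_eq0.
by apply: (generic_mono fu) => y ->; rewrite invfM invr_expz.
Qed.

Lemma has_order_cst x c : c != 0 -> has_order x (fun=> c) 0.
Proof.
move=> c0; exists (fun=> c); split=> //; first exact: reg_cst.
by apply: generic_all => y; rewrite mul1r.
Qed.

Lemma has_orderXz x f i j : has_order x f i ->
  has_order x (fun y => f y ^ j) (i * j).
Proof.
have nat m : has_order x f i -> has_order x (fun y => f y ^+ m) (i * m%:Z).
  move=> fi; elim: m => [|m IH].
    rewrite mulr0; apply: has_order_ext (has_order_cst x (oner_neq0 k)).
    by apply: generic_all => y; rewrite expr0.
  have := has_orderM fi IH; rewrite -[X in X + i * _]mulr1 -mulrDr -PoszD add1n.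
  by apply: has_order_ext; apply: generic_all => y; rewrite exprS.
move=> fi; case: j => m; first exact: nat.
rewrite NegzE mulrN; have := has_orderV (nat m.+1 fi).
by apply: has_order_ext; apply: generic_all => y; rewrite -invr_expz.
Qed.

Lemma has_order_param x : has_order x (param x) 1.
Proof.
exists (fun=> 1); split; [exact: reg_cst|exact: oner_neq0|].
by apply: generic_all => y; rewrite expr1z mulr1.
Qed.

Lemma has_order_neq0 x f i : has_order x f i -> generic (fun y => f y != 0).
Proof.
move=> [u [ru ux fu]].
apply: (generic_mono3 fu (param_neq0 x) (reg_neq0_generic ru ux)) => y -> t0 u0.
by rewrite mulf_neq0 // expfz_neq0.
Qed.

Lemma has_order_uniq x f i j : has_order x f i -> has_order x f j -> i = j.
Proof.
wlog ij : i j / i <= j => [H fi fj|].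
  by case/orP: (le_total i j) => /H; [apply|move=> E; rewrite E].
move=> [u [ru ux fu]] [v [rv vx fv]]; apply/eqP; rewrite eq_le ij /= leNgt.
apply/negP => ltij.
have [m Em] : exists m : nat, j = i + m.+1%:Z.
  exists (`|j - i|.-1)%N; rewrite prednK ?absz_gt0 ?subr_eq0 ?gt_eqF //.
  by rewrite gez0_abs ?subr_ge0 // addrCA subrr addr0.
case/eqP: ux; have rw : reg x (fun y => param x y ^+ m.+1 * v y).
  by apply: regM => //; apply: regX => //; exact: reg_param.
have -> : u x = param x x ^+ m.+1 * v x.
  apply: (reg_eq_generic ru rw).
  apply: (generic_mono3 fu fv (param_neq0 x)) => y -> E t0;
    apply: (mulfI (expfz_neq0 i t0)).
  by rewrite E Em expfzDr // -mulrA.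
by rewrite param0 exprS !mul0r.
Qed.

Lemma reg_has_order0 x f : reg x f -> f x != 0 -> has_order x f 0.
Proof.
by move=> rf fx; exists f; split=> //; apply: generic_all => y; rewrite mul1r.
Qed.

Lemma extends_at_order x f : extends_at x f ->
  generic (fun y => f y = 0) \/ exists m : nat, has_order x f m%:Z.
Proof.
move=> [g [rg fg]]; case: (reg_fact rg) => [g0|[m [u [ru ux gu]]]].
  by left; apply: (generic_mono2 fg g0) => y ->.
by right; exists m, u; split=> //; apply: (generic_mono2 fg gu) => y ->.
Qed.

Lemma has_order_ge x f i j : i <= j -> has_order x f j -> order_ge x i f.
Proof.
rewrite -subr_ge0 => ij [u [ru ux fu]].
exists (fun y => param x y ^+ `|j - i|%N * u y); split.
  by apply: regM => //; apply: regX => //; exact: reg_param.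
apply: (generic_mono2 fu (param_neq0 x)) => y -> t0.
by rewrite mulrA -expfzDr // (addrC (- i)) exprnP gez0_abs.
Qed.

Lemma order_geE x f i : order_ge x i f -> generic (fun y => f y = 0) \/
  exists2 j, i <= j & has_order x f j.
Proof.
case/extends_at_order => [f0|[m om]]; [left|right].
  apply: (generic_mono2 f0 (param_neq0 x)) => y /eqP;
    rewrite mulf_eq0 => /orP [|/eqP->//].
  by move=> H t0; move: H; rewrite (negPf (expfz_neq0 (- i) t0)).
exists (i + m%:Z); first by rewrite lerDl.
have := has_orderM (has_orderXz i (has_order_param x)) om; rewrite mul1r.
apply: has_order_ext; apply: (generic_mono (param_neq0 x)) => y t0.
by rewrite mulrA -expfzDr // subrr mul1r.
Qed.

Lemma order_ge0 x f : order_ge x 0 f <-> extends_at x f.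
Proof. by split; apply: extends_at_ext; apply: generic_all => y;
  rewrite oppr0 mul1r. Qed.

Lemma has_order_extends x f i : 0 <= i -> has_order x f i -> extends_at x f.
Proof. by move=> i0 /(has_order_ge i0) /order_ge0. Qed.

Lemma order_ge_ext x f g i : generic (fun y => f y = g y) -> order_ge x i f ->
  order_ge x i g.
Proof. by move=> fg; apply: extends_at_ext; apply: (generic_mono fg) => y ->. Qed.

Lemma order_geM x f g i j : order_ge x i f -> order_ge x j g ->
  order_ge x (i + j) (fun y => f y * g y).
Proof.
move=> vf vg; apply: extends_at_ext (extends_atM vf vg);
  apply: (generic_mono (param_neq0 x)) => y t0.
by rewrite opprD expfzDr //; ring.
Qed.

(** The pole or zero of f is lowered by subtracting the multiple of g with the
    same leading coefficient. *)
Lemma has_order_cancel x f g i : has_order x f i -> has_order x g i ->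
  exists c, c != 0 /\ order_ge x (i + 1) (fun y => f y - c * g y).
Proof.
move=> [u [ru ux fu]] [v [rv vx gv]]; exists (u x / v x); split.
  by rewrite mulf_neq0 // invr_eq0.
have rw : reg x (fun y => u y - u x / v x * v y) by apply: regB => //; exact: regZ.
have [|a [ra E]] := param_dvd rw; first by rewrite divfK // subrr.
exists a; split=> //; apply: (generic_mono4 fu gv E (param_neq0 x)) => y ->
  -> Ey t0.
rewrite [X in _ * X](_ : _ = param x y ^ i * (u y - u x / v x * v y)); last by ring.
by rewrite Ey mulrA -expfzDr // opprD addrAC addNr add0r mulrA -invr_expz expr1z
  mulVf // mul1r.
Qed.

Lemma rationalM f g : rational f -> rational g -> rational (fun y => f y * g y).
Proof.
move=> /rational_reg_generic gf /rational_reg_generic gg.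
have [y [rf rg]] := generic_ex (generic_mono2 gf gg (fun y => @conj _ _)).
by exists y; apply: reg_extends; apply: regM.
Qed.

(** A rational function is a fraction a / b of forms of equal degree, and in the
    chart at any x both are regular functions. *)
Lemma rational_order f : rational f -> generic (fun y => f y = 0) \/
  forall x, exists i, has_order x f i.
Proof.
move=> [x0 [g [[d [a [b [ah bh bx0 gx0 gab]]]] fg]]].
have [f0|nf0] := pselect (generic (fun y => f y = 0)); [by left|right=> x].
have ra := @reg_affine _ _ _ Y_curve x a; have rb := @reg_affine _ _ _ Y_curve x b.
have E y : hcoord (val y) (chart x) != 0 ->
    a.@[affine x y] / b.@[affine x y] = heval a (val y) / heval b (val y).
  move=> y0; rewrite !(heval_affine x y ah, heval_affine x y bh) -mulf_div divff
    ?mul1r //.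
  by rewrite expf_neq0 // invr_eq0.
have fE : generic (fun y => a.@[affine x y] / b.@[affine x y] = f y).
  by apply: (generic_mono3 fg gab (chart_generic x)) => y -> -> /E.
case: (extends_at_order (reg_extends ra)) => [a0|[m oa]].
  by case: nf0; apply: (generic_mono2 fE a0) => y <- ->; rewrite mul0r.
case: (extends_at_order (reg_extends rb)) => [b0|[m' ob]].
  by case: nf0; apply: (generic_mono2 fE b0) => y <- ->; rewrite invr0 mulr0.
by exists (m%:Z - m'%:Z); apply: has_order_ext fE (has_orderM oa (has_orderV ob)).
Qed.

End Orders.

(** * Derivations and linear systems *)

Section Derivations.
Variables (k : closedFieldType) (n : nat) (Y : set (projspace k n)).
Context {Y_curve : nonsingular_projective_curve Y}.
Implicit Types (U V : set Y) (x y z : Y) (f g u : Y -> k).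
Implicit Types (d : (Y -> k) -> k).

Section OnePoint.
Variables (y : Y) (d : (Y -> k) -> k).
Hypothesis der : point_derivation y d.

Lemma der_ext f g : reg y f -> f y = g y -> generic (fun z => f z = g z) ->
  d f = d g.
Proof.
move=> rf fgy fg; have [E _ _] := der; apply: E.
- exact/regP.
- by apply/regP; exact: reg_ext fg.
- exact/near_eqP.
Qed.

Lemma der_lin c f g : reg y f -> reg y g ->
  d (fun z => c * f z + g z) = c * d f + d g.
Proof. by move=> /regP rf /regP rg; have [_ + _] := der; apply. Qed.

Lemma derM f g : reg y f -> reg y g ->
  d (fun z => f z * g z) = f y * d g + g y * d f.
Proof. by move=> /regP rf /regP rg; have [_ _] := der; apply. Qed.

Lemma der_cst c : d (fun=> c) = 0.
Proof.
have d1 : d (fun=> 1) = 0.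
  have r1 : reg y (fun=> 1 : k) := reg_cst 1 y.
  have := derM r1 r1; rewrite (_ : (fun _ : Y => 1 * 1) = fun=> 1).
    by rewrite !mul1r => /eqP; rewrite -subr_eq0 opprD addrA subrr sub0r oppr_eq0
      => /eqP.
  by apply/funext => z; rewrite mul1r.
have d0 : d (fun=> 0) = 0.
  have r0 : reg y (fun=> 0 : k) := reg_cst 0 y.
  have := der_lin 1 r0 r0; rewrite (_ : (fun _ : Y => 1 * 0 + 0) = fun=> 0).
    by rewrite !mul1r => /eqP; rewrite -subr_eq0 opprD addrA subrr sub0r oppr_eq0
      => /eqP.
  by apply/funext => z; rewrite mul1r addr0.
have := der_lin c (reg_cst 1 y) (reg_cst 0 y).
rewrite (_ : (fun _ : Y => c * 1 + 0) = fun=> c); last first.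
  by apply/funext => z; rewrite mulr1 addr0.
by rewrite d1 d0 mulr0 addr0.
Qed.

Lemma derD f g : reg y f -> reg y g -> d (fun z => f z + g z) = d f + d g.
Proof.
move=> rf rg; rewrite -[in RHS](mul1r (d f)) -der_lin //; congr d.
by apply/funext => z; rewrite mul1r.
Qed.

Lemma der_sum m (c : 'I_m -> k) (f : 'I_m -> Y -> k) : (forall i, reg y (f i)) ->
  d (fun z => \sum_(i < m) c i * f i z) = \sum_(i < m) c i * d (f i).
Proof.
elim: m c f => [|m IH] c f rf.
  rewrite big_ord0 -[RHS](der_cst 0); congr d.
  by apply/funext => z; rewrite big_ord0.
rewrite big_ord_recl -IH => [|i]; last exact: rf.
rewrite -der_lin //; last by apply: reg_sum => i; exact: regZ.
by congr d; apply/funext => z; rewrite big_ord_recl.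
Qed.

Lemma derX f m : reg y f -> d (fun z => f z ^+ m.+1) = (m.+1)%:R * f y ^+ m * d f.
Proof.
move=> rf; elim: m => [|m IH].
  rewrite expr0 !mul1r; congr d.
rewrite (_ : (fun z => f z ^+ m.+2) = fun z => f z * f z ^+ m.+1); last first.
  by apply/funext => z; rewrite exprS.
rewrite derM //; last exact: regX.
by rewrite IH -(@natr1 _ m.+1) !exprS; ring.
Qed.

(** The chain rule, by induction on the polynomial. *)
Lemma der_mpoly m (v : 'I_m -> Y -> k) (p : {mpoly k[m]}) : (forall i,
  reg y (v i)) ->
  reg y (fun z => p.@[v^~ z]) /\
  d (fun z => p.@[v^~ z]) = \sum_(i < m) p^`M(i).@[v^~ y] * d (v i).
Proof.
move=> rv; elim/mpoly_ring_ind: p => [c|i|p q [rp IHp] [rq IHq]|p q [rp IHp] [rq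
  IHq]].
- under eq_fun do rewrite mevalC; split; first exact: reg_cst.
  by rewrite der_cst big1 // => i _; rewrite mderivC meval0 mul0r.
- under eq_fun do rewrite mevalXU; split; first exact: rv.
  rewrite (bigD1 i) //= mderivX mnm1E eqxx scale1r (_ : (U_(i) - U_(i))%MM =
    0%MM) ?mpolyX0 ?meval1 ?mul1r; last by apply/mnmP => l;
      rewrite mnmBE subnn mnm0E.
  rewrite (_ : v i = fun z => v i z) // big1 ?addr0 // => l li.
  by rewrite mderivX mnm1E eq_sym (negPf li) scale0r meval0 mul0r.
- under eq_fun do rewrite mevalD; split; first exact: regD.
  rewrite derD // IHp IHq -big_split /=; apply: eq_bigr => i _.
  by rewrite mderivD mevalD mulrDl.
- under eq_fun do rewrite mevalM; split; first exact: regM.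
  rewrite derM // IHp IHq !mulr_sumr -big_split /=; apply: eq_bigr => i _.
  by rewrite mderivM mevalD !mevalM; ring.
Qed.

Lemma der_frac f g h : reg y f -> reg y g -> reg y h -> f y * g y = h y ->
  generic (fun z => f z * g z = h z) -> d f * g y = d h - f y * d g.
Proof.
move=> rf rg rh Ey E; rewrite -(der_ext (regM rf rg) Ey E) derM //; ring.
Qed.

End OnePoint.

(** The derivative at y with respect to the local parameter t: the value at y of
    (f - f(y)) / t. *)
Definition param_der y f : k :=
  if pselect (exists a, reg y a /\ generic (fun z => f z - f y =
    param y z * a z)) is left H
  then projT1 (cid H) y else 0.

Lemma param_derE y f a : reg y a -> generic (fun z => f z - f y =
  param y z * a z) -> param_der y f = a y.
Proof.
move=> ra E; rewrite /param_der; case: pselect => [H|]; last by case; exists a.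
case: (cid H) => b [rb Eb] /=; apply: (reg_eq_generic rb ra).
by apply: (generic_mono3 E Eb (param_neq0 y)) => z -> Ez t0; apply: (mulfI t0).
Qed.

Lemma param_der_wit y f : reg y f -> exists a,
  [/\ reg y a, generic (fun z => f z - f y = param y z * a z) & param_der y f =
    a y].
Proof.
move=> rf.
have rw : reg y (fun z => f z - f y) by apply: regB => //; exact: reg_cst.
have [|a [ra E]] := param_dvd rw; first by rewrite subrr.
by exists a; split=> //; apply: param_derE.
Qed.

Lemma param_der_derivation y : point_derivation y (param_der y).
Proof.
split.
- move=> f u /regP rf /regP ru /near_eqP [fuy fu].
  have [a [ra E ->]] := param_der_wit rf; apply/esym/param_derE => //.
  by apply: (generic_mono2 E fu) => z; rewrite fuy => E1 <-.
- move=> c f u /regP rf /regP ru.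
  have [a [ra E ->]] := param_der_wit rf; have [b [rb F ->]] := param_der_wit ru.
  rewrite (@param_derE _ _ (fun z => c * a z + b z)) //.
    by apply: regD => //; exact: regZ.
  apply: (generic_mono2 E F) => z Ez Fz; rewrite mulrDr mulrCA -Ez -Fz; ring.
move=> f u /regP rf /regP ru.
have [a [ra E ->]] := param_der_wit rf; have [b [rb F ->]] := param_der_wit ru.
rewrite (@param_derE _ _ (fun z => f z * b z + u y * a z)) //.
  by apply: regD; [exact: regM|exact: regZ].
apply: (generic_mono2 E F) => z Ez Fz.
rewrite (_ : param y z * _ = f z * (param y z * b z) + u y * (param y z * a z));
  last by ring.
rewrite -Ez -Fz; ring.
Qed.

Lemma param_der_param y : param_der y (param y) = 1.
Proof.
rewrite (@param_derE _ _ (fun=> 1)) //; first exact: reg_cst.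
by apply: generic_all => z; rewrite param0 subr0 mulr1.
Qed.

Lemma reg_det x m (M : 'I_m -> 'I_m -> Y -> k) : (forall i j, reg x (M i j)) ->
  reg x (fun y => \det (\matrix_(i, j) M i j y)).
Proof.
move=> rM; rewrite /determinant; apply: reg_sum => s.
apply: regZ; under eq_fun do under eq_bigr do rewrite mxE.
by apply: reg_prod => i.
Qed.

Lemma reg_adj x m (M : 'I_m -> 'I_m -> Y -> k) i j : (forall i j, reg x (M i j)) ->
  reg x (fun y => (\adj (\matrix_(i, j) M i j y)) i j).
Proof.
move=> rM; under eq_fun do rewrite mxE /cofactor; apply: regZ.
pose N a b := M (lift j a) (lift i b).
rewrite (_ : (fun y => _) = fun y => \det (\matrix_(a, b) N a b y));
  first by apply: reg_det => a b; exact: rM.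
by apply/funext => y; congr (\det _); apply/matrixP => a b; rewrite !mxE.
Qed.

(** Nakayama's lemma as Cramer's rule.  Near x each coordinate is
    z_j = z_j(x) + t a_j, where a_j is a fraction of polynomials in the z_l; hence
    dz = a dt + t C dz with C regular at x, and 1 - t C is invertible near x. *)
Lemma affine_der x : exists e : 'I_n.+1 -> Y -> k, (forall j, reg x (e j)) /\
  generic (fun y => forall d, point_derivation y d ->
    forall j, d (fun z => affine x z j) = e j y * d (param x)).
Proof.
have wit j : exists apq : (Y -> k) * ({mpoly k[n.+1]} * {mpoly k[n.+1]}),
   [/\ reg x apq.1, generic (fun z => affine x z j - affine x x j =
     param x z * apq.1 z),
     apq.2.2.@[affine x x] != 0 &
    generic (fun z => apq.1 z * apq.2.2.@[affine x z] = apq.2.1.@[affine x z])].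
  have rw : reg x (fun z => affine x z j - affine x x j).
    by apply: regB; [exact: reg_affineX|exact: reg_cst].
  have [|a [ra Ea]] := param_dvd rw; first by rewrite subrr.
  have [p [q [qx px E]]] := reg_affine_atP (chart_neq0 x) ra.
  by exists (a, (p, q)).
pose a j := (projT1 (cid (wit j))).1.
pose p j := (projT1 (cid (wit j))).2.1.
pose q j := (projT1 (cid (wit j))).2.2.
have W j : [/\ reg x (a j), generic (fun z => affine x z j - affine x x j =
  param x z * a j z),
     (q j).@[affine x x] != 0 & generic (fun z => a j z * (q j).@[affine x z] =
       (p j).@[affine x z])].
  exact: (projT2 (cid (wit j))).
pose C j l z := ((p j)^`M(l).@[affine x z] - a j z * (q j)^`M(l).@[affine x z]) /
  (q j).@[affine x z].
have rpr := @reg_param _ _ _ Y_curve x.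
have rC j l : reg x (C j l).
  have [ra _ qx _] := W j; apply: regM; last by apply: regV => //;
    exact: reg_affine.
  by apply: regB; [exact: reg_affine|apply: regM => //; exact: reg_affine].
pose M (j l : 'I_n.+1) z : k := (j == l)%:R - @param _ _ _ Y_curve x z * C j l z.
have rM j l : reg x (M j l) by apply: regB; [exact: reg_cst|exact: regM].
pose dt z := \det (\matrix_(j, l) M j l z).
have rdt : reg x dt by exact: reg_det.
have dtx : dt x != 0.
  rewrite /dt (_ : \matrix_(j, l) _ = 1%:M) ?det1 ?oner_eq0 //.
  by apply/matrixP => j l; rewrite !mxE /M param0 mul0r subr0.
exists (fun j z => (dt z)^-1 * \sum_l (\adj (\matrix_(j,
  l) M j l z)) j l * a l z); split.
  move=> j; apply: regM; first exact: regV.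
  by apply: reg_sum => l; apply: regM; [exact: reg_adj|case: (W l)].
have g1 j : generic (fun y => [/\ reg y (a j),
    affine x y j - affine x x j = param x y * a j y /\
      a j y * (q j).@[affine x y] = (p j).@[affine x y] & (q j).@[affine x y] !=
        0]).
  have [ra E1 qx E2] := W j.
  have gq : generic (fun y => (q j).@[affine x y] != 0) by apply:
    reg_neq0_generic qx; exact: reg_affine.
  by apply: (generic_mono4 (reg_generic ra) E1 E2 gq) => y *; split.
apply: (generic_mono4 (generic_forall g1) (chart_generic x) (reg_generic rpr)
  (reg_neq0_generic rdt dtx)).
move=> y H1 y0 rt dty d der.
have raff l : reg y (fun z => affine x z l) by exact: reg_affine_at.
pose v := \col_l d (fun z => affine x z l).
(* The system (1 - t C) dz = a dt at the point y. *)
have key : (\matrix_(j, l) M j l y) *m v = \col_l (a l y * d (param x)).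
  apply/matrixP => j o; rewrite {o}ord1 !mxE.
  have [ra [E1 E2] qy] := H1 j; have [_ G1 _ G2] := W j.
  have da : d (a j) = \sum_l C j l y * d (fun z => affine x z l).
    have [rq dq] := der_mpoly der (q j) raff;
      have [rp dp] := der_mpoly der (p j) raff.
    have := der_frac der ra rq rp E2 G2; rewrite dq dp => F.
    apply: (mulIf qy); rewrite F mulr_suml mulr_sumr -sumrB.
    by apply: eq_bigr => l _; rewrite /C; field.
  have dz : d (fun z => affine x z j) = param x y * d (a j) + a j y * d (param x).
    rewrite -(derM der) // -[RHS]add0r -(der_cst der (affine x x j)).
    rewrite -(derD der) //; [|exact: reg_cst|exact: regM].
    apply: (der_ext der (raff j)); first by rewrite -E1; ring.
    by apply: (generic_mono G1) => z <-; ring.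
  have -> : a j y * d (param x) = d (fun z =>
    affine x z j) - param x y * d (a j) by rewrite dz; ring.
  rewrite da mulr_sumr; under eq_bigr do rewrite !mxE mulrBl.
  rewrite sumrB; congr (_ - _); last by apply: eq_bigr => l _; rewrite -mulrA.
  rewrite (bigD1 j) //= eqxx mul1r big1 ?addr0 // => l.
  by rewrite eq_sym => /negPf ->; rewrite mul0r.
move=> j; apply: (mulfI dty); rewrite 2!mulrA divff // mul1r.
have := congr1 (fun A => (\adj (\matrix_(j, l) M j l y) *m A) j ord0) key.
rewrite mulmxA mul_adj_mx mul_scalar_mx !mxE => ->; rewrite mulr_suml.
by apply: eq_bigr => l _; rewrite !mxE mulrA.
Qed.

(** The derivation D is meant to be d/dt for a function t that is a local
    parameter, up to a constant, at almost every point. *)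
Definition good_derivation_at (D : (Y -> k) -> Y -> k) y :=
  [/\ point_derivation y (D^~ y), D (param y) y != 0 & forall f, reg y f ->
    reg y (D f)].

(** With t the parameter at x, D f is the quotient of the derivatives of f and
    of t with respect to the parameter at each point.  It preserves regularity since,
    by the chain rule, it is a combination of the derivatives of the coordinates. *)
Lemma derivation_ex x : exists D, generic (good_derivation_at D).
Proof.
have [e [re ge]] := affine_der x.
pose D f y : k := param_der y f / param_der y (@param _ _ _ Y_curve x).
pose H1 y := forall d, point_derivation y d ->
    forall j, d (fun z => affine x z j) = e j y * d (@param _ _ _ Y_curve x).
have formula y f (p q : {mpoly k[n.+1]}) : H1 y ->
  hcoord (val y) (chart x) != 0 -> reg y f ->
    q.@[affine x y] != 0 -> f y * q.@[affine x y] = p.@[affine x y] ->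
    generic (fun z => f z * q.@[affine x z] = p.@[affine x z]) ->
    param_der y f = (\sum_j (p^`M(j).@[affine x y] - f y * q^`M(j).@[affine x y])
      / q.@[affine x y] * e j y)
       * param_der y (param x).
  move=> h1 y0 rf qy E G; have der := param_der_derivation y.
  have raff l : reg y (fun z => affine x z l) by exact: reg_affine_at.
  have [rq dq] := der_mpoly der q raff; have [rp dp] := der_mpoly der p raff.
  have := der_frac der rf rq rp E G; rewrite dq dp => F.
  apply: (mulIf qy); rewrite F !mulr_suml mulr_sumr -sumrB.
  by apply: eq_bigr => l _; rewrite (h1 _ der); field.
have dlt y : H1 y -> hcoord (val y) (chart x) != 0 -> param_der y (param x) != 0.
  move=> h1 y0; apply/eqP => d0.
  have rt := @reg_param _ _ _ Y_curve y.
  have [p [q [qy E G]]] := reg_affine_atP y0 rt.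
  have := formula _ _ _ _ h1 y0 rt qy E G; rewrite param_der_param d0 mulr0 => /eqP.
  by rewrite oner_eq0.
exists D; apply: (generic_mono3 ge (chart_generic x) (generic_forall (fun j =>
  reg_generic (re j)))).
move=> y h1 y0 rey; have t0 := dlt y h1 y0; split.
- have [E L M] := param_der_derivation y; split.
  + by move=> f u rf ru fu; rewrite /D (E f u).
  + by move=> c f u rf ru; rewrite /D L //; field.
  + by move=> f u rf ru; rewrite /D M //; field.
- by rewrite /D param_der_param mul1r invr_eq0.
move=> f rf; have [p [q [qy E G]]] := reg_affine_atP y0 rf.
have raff : forall l, reg y (fun z => affine x z l) by move=> l;
  exact: reg_affine_at.
have rp (r : {mpoly k[n.+1]}) : reg y (fun z => r.@[affine x z]).
  exact: (der_mpoly (param_der_derivation y) r raff).1.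
pose F z := \sum_j (p^`M(j).@[affine x z] - f z * q^`M(j).@[affine x z]) /
  q.@[affine x z] * e j z.
apply: (@reg_ext _ _ _ y F).
- apply: reg_sum => j; apply: regM => //; apply: regM; last exact: regV.
  by apply: regB => //; exact: regM.
- by rewrite /D (formula y f p q) // mulfK.
apply: (generic_mono2 (generic_mono2 ge (chart_generic x) (fun y =>
  @conj _ _)) (generic_mono3 (reg_generic rf) G (reg_neq0_generic (rp q) qy) (fun
    y a b c => And3 a b c))).
move=> z [h1z z0] [rz Gz qz].
by rewrite /D (formula z f p q) // mulfK //; exact: dlt.
Qed.

Hypothesis char0 : [pchar k] =i pred0.

Lemma natS_neq0 m : (m.+1)%:R != 0 :> k.
Proof. by have /pcharf0P -> := char0. Qed.

Lemma order_ge_param y m f : order_ge y m%:Z f ->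
  exists a, reg y a /\ generic (fun z => f z = param y z ^+ m * a z).
Proof.
move=> [a [ra E]]; exists a; split=> //; apply: (generic_mono2 E (param_neq0 y))
  => z <- t0.
by rewrite mulrA exprnP -invr_expz mulfV ?mul1r // expfz_neq0.
Qed.

Lemma order_ge_intro y m f a : reg y a -> generic (fun z => f z =
  param y z ^+ m * a z) -> order_ge y m%:Z f.
Proof.
move=> ra E; exists a; split=> //; apply: (generic_mono2 E (param_neq0 y)) =>
  z -> t0.
by rewrite mulrA exprnP -invr_expz mulVf ?mul1r // expfz_neq0.
Qed.

Section Wronskian.
Variable D : (Y -> k) -> Y -> k.
Hypothesis gD : generic (good_derivation_at D).

(** Leibniz's rule for t^(m+1) u. *)
Lemma D_formula y m u f : good_derivation_at D y -> reg y u ->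
  generic (fun z => f z = param y z ^+ m.+1 * u z) ->
  generic (fun z => D f z = param y z ^+ m * ((m.+1)%:R * u z * D (param y) z +
    param y z * D u z)).
Proof.
move=> gy ru E; have rt := @reg_param _ _ _ Y_curve y.
apply: (generic_mono4 gD (reg_generic rt) (reg_generic ru) E) =>
  z [der _ _] rtz ruz Ez.
have rtm : reg z (fun w => param y w ^+ m.+1) by exact: regX.
rewrite -[LHS](@der_ext _ _ der (fun w => param y w ^+ m.+1 * u w)); first last.
- by apply: (generic_mono E).
- by [].
- exact: regM.
by rewrite (derM der) // (derX der) // exprS; ring.
Qed.

Lemma D_order_ge y m f : good_derivation_at D y -> order_ge y m.+1%:Z f ->
  order_ge y m%:Z (D f).
Proof.
move=> gy /order_ge_param [a [ra E]]; have [der _ rD] := gy;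
  have rt := @reg_param _ _ _ Y_curve y.
apply: order_ge_intro (D_formula gy ra E).
apply: regD; last by apply: regM => //; exact: rD.
by apply: regM; [exact: regZ|exact: rD].
Qed.

(** Otherwise f - f(y) = t^(m+1) u with u(y) != 0, and the derivative would have
    order m because m + 1 is invertible in characteristic zero. *)
Lemma D_const y f : good_derivation_at D y -> reg y f ->
  generic (fun z => D f z = 0) ->
  generic (fun z => f z = f y).
Proof.
move=> gy rf Df0; have [der Dt rD] := gy; have rt := @reg_param _ _ _ Y_curve y.
have rw : reg y (fun z => f z - f y) by apply: regB => //; exact: reg_cst.
case: (reg_fact rw) => [w0|[[|m] [u [ru uy E]]]].
- by apply: (generic_mono w0) => z /eqP; rewrite subr_eq0 => /eqP.
- case/eqP: uy; rewrite -(reg_eq_generic rw ru) ?subrr //.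
  by apply: (generic_mono E) => z ->; rewrite mul1r.
have E2 := D_formula gy ru E.
have rtot : reg y (fun z => (m.+1)%:R * u z * D (param y) z + param y z * D u z).
  apply: regD; last by apply: regM => //; exact: rD.
  by apply: regM; [exact: regZ|exact: rD].
have /eqP : (m.+1)%:R * u y * D (param y) y + param y y * D u y = 0.
  apply: (reg_eq_generic rtot (reg_cst 0 y)).
  apply: (generic_mono4 E2 Df0 (param_neq0 y) (generic_mono2 gD (reg_generic rf)
    (fun z => @conj _ _))).
  move=> z E3 D0 t0 [[derz _ _] rfz].
  have Dw : D (fun w => f w - f y) z = 0.
    rewrite (_ : (fun w => _) = fun w => 1 * f w + (- f y)); last first.
      by apply/funext => w; rewrite mul1r.
    by rewrite (der_lin derz) // ?(der_cst derz) ?D0 ?mulr0 ?addr0 //;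
      exact: reg_cst.
  by move/eqP: E3; rewrite Dw eq_sym mulf_eq0 (negPf (expf_neq0 _ t0)) => /eqP.
by rewrite param0 mul0r addr0 !mulf_eq0 (negPf (natS_neq0 m)) (negPf uy) (negPf Dt).
Qed.

Lemma order_ge_le y (i j : int) f : i <= j -> order_ge y j f -> order_ge y i f.
Proof.
move=> ij; case/order_geE => [f0|[l jl ol]];
  last exact: has_order_ge (le_trans ij jl) ol.
exists (fun=> 0); split; first exact: reg_cst.
by apply: (generic_mono f0) => z ->; rewrite mulr0.
Qed.

(** Induction on r in place of the Wronskian determinant: divide by the first
    function and differentiate.  The quotient system has r - 1 members, vanishing
    orders drop by at most one, and a combination with zero derivative is constant,
    hence zero if it vanishes at the point. *)
Lemma general_vanishing r (phi : 'I_r -> Y -> k) : (forall i, rational (phi i)) ->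
  generic (fun y => forall c : 'I_r -> k, order_ge y r%:Z (fun z =>
    \sum_i c i * phi i z) ->
    generic (fun z => \sum_i c i * phi i z = 0)).
Proof.
elim: r phi => [|r IH] phi rphi.
  by apply: generic_all => y c _; apply: generic_all => z; rewrite big_ord0.
have Hreg := generic_forall (fun i => @rational_reg_generic _ _ _ Y_curve _ (rphi
  i)).
have [y0 r0] := generic_ex (rational_reg_generic (rphi ord0)).
case: (reg_zero_or_neq0 r0) => [p0|p0].
  apply: (generic_mono (IH (fun i => phi (lift ord0 i)) _)) => [i|y Hy c Hc];
    first exact: rphi.
  have E : generic (fun z => \sum_i c i * phi i z =
    \sum_i c (lift ord0 i) * phi (lift ord0 i) z).
    by apply: (generic_mono p0) => z E; rewrite big_ord_recl E mulr0 add0r.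
  apply: (generic_mono2 E (Hy (fun i => c (lift ord0 i)) _)) => [|z -> //].
  by apply: order_ge_ext E _; apply: order_ge_le Hc; rewrite lez_nat.
(* The functions psi and 1 span the quotients by the first function. *)
pose psi (i : 'I_r) z := phi (lift ord0 i) z / phi ord0 z.
have rpsi y i : reg y (phi ord0) -> reg y (phi (lift ord0 i)) ->
  phi ord0 y != 0 -> reg y (psi i).
  by move=> *; apply: regM => //; exact: regV.
have rDpsi i : rational (D (psi i)).
  have [y [[gy yphi] y0n]] := generic_ex (generic_mono2 (generic_mono2 gD Hreg
    (fun z => @conj _ _)) p0 (fun z => @conj _ _)).
  by exists y; apply: reg_extends; case: gy => _ _; apply; exact: rpsi.
apply: (generic_mono4 (IH _ rDpsi) gD Hreg p0) => y IHy gy yphi yn0 c Hc.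
pose F z := c ord0 + \sum_i c (lift ord0 i) * psi i z.
have FE : generic (fun z => (phi ord0 z)^-1 * (\sum_i c i * phi i z) = F z).
  apply: (generic_mono p0) => z z0; rewrite big_ord_recl mulrDr mulrCA mulVf //
    mulr1 /F.
  by congr (_ + _); rewrite mulr_sumr; apply: eq_bigr => i _; rewrite /psi; ring.
have vF : order_ge y r.+1%:Z F.
  rewrite -[r.+1%:Z]add0r; apply: order_ge_ext FE (order_geM _ Hc).
  by apply/order_ge0; apply: reg_extends; exact: regV.
have rF : reg y F.
  by apply: regD; [exact: reg_cst|apply: reg_sum => i; apply: regZ; exact: rpsi].
have DF : generic (fun z => D F z = \sum_i c (lift ord0 i) * D (psi i) z).
  apply: (generic_mono3 gD Hreg p0) => z [der _ _] zphi z0.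
  have rz i : reg z (psi i) by exact: rpsi.
  rewrite (derD der) ?(der_cst der) ?add0r ?(der_sum der) //; first exact: reg_cst.
  by apply: reg_sum => i; apply: regZ.
have D0 : generic (fun z => D F z = 0).
  apply: (generic_mono2 DF (IHy (fun i => c (lift ord0 i)) _)) => [|z -> //].
  exact: order_ge_ext DF (D_order_ge gy vF).
have Fc := D_const gy rF D0.
have Fy : F y = 0.
  have [a [ra E]] := order_ge_param vF; have rt := @reg_param _ _ _ Y_curve y.
  rewrite (reg_eq_generic rF (regM (regX r.+1 rt) ra) E).
  by rewrite param0 exprS !mul0r.
apply: (generic_mono3 FE Fc p0) => z E1 E2 z0; move/eqP: E1.
by rewrite E2 Fy mulf_eq0 invr_eq0 (negPf z0) => /eqP.
Qed.

End Wronskian.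
End Derivations.

(** * Curves with a function having a single simple pole *)

Section RationalCurve.
Variables (k : closedFieldType) (n : nat) (Y : set (projspace k n)).
Context {Y_curve : nonsingular_projective_curve Y}.
Implicit Types (U V : set Y) (x y z P : Y) (f g u h : Y -> k).

(** At each point where f agrees generically with a regular function, the
    value of that function is determined. *)
Lemma regularize f : rational f ->
  exists f', generic (fun y => f y = f' y) /\ forall x, extends_at x f -> reg x f'.
Proof.
move=> rf.
have H x : exists v, forall u, reg x u -> generic (fun y => f y = u y) -> u x = v.
  have [[u [ru E]]|no] := pselect (extends_at x f); last first.
    by exists 0 => u ru E; case: no; exists u.
  exists (u x) => v rv F; apply: reg_eq_generic => //.
  by apply: (generic_mono2 E F) => y <- <-.
pose f' x := projT1 (cid (H x)).
have f'P x u : reg x u -> generic (fun y => f y = u y) -> u x = f' x.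
  exact: (projT2 (cid (H x))).
have ff' : generic (fun y => f y = f' y).
  by apply: (generic_mono (rational_reg_generic rf)) => y ry; apply: f'P => //;
    exact: generic_all.
exists f'; split=> // x [u [ru E]].
apply: (reg_ext ru); first exact: f'P.
by apply: (generic_mono2 ff' E) => y <- ->.
Qed.

Lemma has_order_pos_val0 x f m : reg x f -> has_order x f m.+1%:Z -> f x = 0.
Proof.
move=> rf [u [ru ux E]]; have rt := @reg_param _ _ _ Y_curve x.
by rewrite (reg_eq_generic rf (regM (regX m.+1 rt) ru) E) param0 exprS !mul0r.
Qed.

Lemma reg_horner x h (p : {poly k}) : reg x h -> reg x (fun y => p.[h y]).
Proof.
move=> rh; elim/poly_ind: p => [|p c IH].
  by under eq_fun do rewrite horner0; exact: reg_cst.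
by under eq_fun do rewrite hornerMXaddC; apply: regD; [exact: regM|exact: reg_cst].
Qed.

Lemma der_horner y d h (p : {poly k}) : point_derivation y d -> reg y h ->
  d (fun z => p.[h z]) = p^`().[h y] * d h.
Proof.
move=> der rh; elim/poly_ind: p => [|p c IH].
  by under eq_fun do rewrite horner0; rewrite (der_cst der) deriv0 horner0 mul0r.
have rp := reg_horner p rh.
under eq_fun do rewrite hornerMXaddC.
rewrite (derD der) ?(derM der) ?(der_cst der) //; [|exact: regM|exact: reg_cst].
by rewrite IH derivMXaddC hornerD hornerM hornerX; ring.
Qed.

Hypothesis global_const : forall f, (forall x, reg x f) ->
  exists c, forall y, f y = c.

Lemma extends_everywhere_const f : (forall x, extends_at x f) ->
  exists c, generic (fun y => f y = c).
Proof.
move=> gf; have [x0 _] := generic_ex (@generic_all _ _ Y (fun=> True) (fun=> I)).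
have [|f' [E rf']] := @regularize f; first by exists x0.
have [c fc] := global_const (fun x => rf' x (gf x)).
by exists c; apply: (generic_mono E) => y ->.
Qed.

Section SimplePole.
Variables (P0 : Y) (h : Y -> k).
Hypotheses (hreg : forall x, x <> P0 -> reg x h) (hpole : has_order P0 h (-1)).

(** A function with a pole of order m at P0 is lowered by a multiple of h^m,
    and a function without poles is constant. *)
Lemma reg_off_pole_poly f : (forall x, x <> P0 -> extends_at x f) ->
  exists p : {poly k}, generic (fun y => f y = p.[h y]).
Proof.
have step m : forall f, (forall x, x <> P0 -> extends_at x f) ->
  order_ge P0 (- m%:Z) f ->
    exists p : {poly k}, generic (fun y => f y = p.[h y]).
  elim: m => [|m IH] {}f gf vf.
    have [|c fc] := @extends_everywhere_const f.
      move=> x; have [->|/gf//] := pselect (x = P0); exact/order_ge0.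
    by exists c%:P; apply: (generic_mono fc) => y ->; rewrite hornerC.
  case: (order_geE vf) => [f0|[j jm oj]].
    by exists 0; apply: (generic_mono f0) => y ->; rewrite horner0.
  have [jm'|jm'] := leP (- m%:Z) j; first by apply: IH => //;
    exact: has_order_ge oj.
  have Ej : j = - m.+1%:Z by lia.
  have oh : has_order P0 (fun y => h y ^+ m.+1) j.
    have := has_orderXz m.+1 hpole; rewrite mulN1r Ej.
    by apply: has_order_ext; apply: generic_all.
  have [c [_ vc]] := has_order_cancel oj oh.
  have [||p Ep] := IH (fun y => f y - c * h y ^+ m.+1).
  - move=> x xP; apply: extends_atD; first exact: gf.
    apply: reg_extends; apply: regN; apply: regZ; apply: regX; exact: hreg.
  - by move: vc; rewrite Ej (_ : - m.+1%:Z + 1 = - m%:Z) //; lia.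
  exists (p + c *: 'X^(m.+1)); apply: (generic_mono Ep) => y E.
  by rewrite hornerD hornerZ hornerXn -E subrK.
move=> gf; have [x xP] := generic_ex (generic_neq P0).
have [f0|/(_ P0) [i oi]] := rational_order (ex_intro _ x (gf x xP)).
  by exists 0; apply: (generic_mono f0) => y ->; rewrite horner0.
by apply: (step `|i|%N) => //; apply: has_order_ge oi; lia.
Qed.

Lemma pole_nonconst c : generic (fun y => h y - c != 0).
Proof.
have [x xP] := generic_ex (generic_neq P0).
have rw : reg x (fun y => h y - c) by apply: regB; [exact: hreg|exact: reg_cst].
case: (reg_zero_or_neq0 rw) => // w0; exfalso.
have [c0|c0] := eqVneq c 0.
  have [y [/eqP]] := generic_ex (generic_mono2 w0 (has_order_neq0 hpole) (fun y
    => @conj _ _)).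
  by rewrite c0 subr0 => /eqP ->; rewrite eqxx.
have : has_order P0 h 0.
  apply: has_order_ext (has_order_cst P0 c0); apply: (generic_mono w0) => y /eqP.
  by rewrite subr_eq0 => /eqP.
by move/(has_order_uniq hpole).
Qed.

(** Each pole at x other than P0 is cleared by a power of h - h(x). *)
Lemma rational_frac g : rational g ->
  exists p q : {poly k}, q != 0 /\ generic (fun y => g y * q.[h y] = p.[h y]).
Proof.
have step (s : seq Y) : forall g, rational g -> (forall x, x <> P0 ->
  ~ (x \in s) -> extends_at x g) ->
    exists p q : {poly k}, q != 0 /\ generic (fun y => g y * q.[h y] = p.[h y]).
  elim: s => [|x0 s IH] {}g rg gg.
    have [|p Ep] := @reg_off_pole_poly g; first by move=> x xP; apply: gg.
    by exists p, 1; split; rewrite ?oner_neq0 //;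
      apply: (generic_mono Ep) => y ->; rewrite hornerC mulr1.
  have [x0P|x0P] := pselect (x0 = P0).
    apply: IH => // x xP xs; apply: gg => //; rewrite inE => /orP [/eqP|//].
    by rewrite x0P.
  have [g0|/(_ x0) [i oi]] := rational_order rg.
    by exists 0, 1; split; rewrite ?oner_neq0 //;
      apply: (generic_mono g0) => y ->; rewrite horner0 mul0r.
  pose N := `|i|%N.
  have rw x : x <> P0 -> reg x (fun y => h y - h x0).
    by move=> xP; apply: regB; [exact: hreg|exact: reg_cst].
  have [||p [q [q0 E]]] := IH (fun y => g y * (h y - h x0) ^+ N).
  - apply: rationalM => //; exists x0; apply: reg_extends; apply: regX; exact: rw.
  - move=> x xP xs; have [->|xx0] := pselect (x = x0); last first.
      apply: extends_atM; last by apply: reg_extends; apply: regX; exact: rw.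
      by apply: gg => //; rewrite inE => /orP [/eqP|//].
    have [|a [ra E]] := param_dvd (rw _ x0P); first by rewrite subrr.
    apply/order_ge0; apply: (@order_ge_le _ _ _ _ _ _ (i + N%:Z));
      first by rewrite /N; lia.
    apply: order_geM; first exact: has_order_ge oi.
    apply: (@order_ge_intro _ _ _ _ _ _ _ (fun y => a y ^+ N)); first exact: regX.
    by apply: (generic_mono E) => y ->; rewrite exprMn.
  exists p, (('X - (h x0)%:P) ^+ N * q); split.
    by rewrite mulf_neq0 // expf_neq0 // polyXsubC_eq0.
  by apply: (generic_mono E) => y <-; rewrite hornerM horner_exp hornerXsubC mulrA.
move=> rg; have /finite_seqP [s Es] : finite_set [set y | ~ reg y g] by exact:
  rational_reg_generic.
apply: (step s) => // x _ xs; apply: reg_extends; apply: contrapT => nr; apply: xs.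
by have : [set y | ~ reg y g] x by []; rewrite Es.
Qed.

(** In a fraction p(h) / q(h) that is regular at P, a zero of q at h(P) is also a
    zero of p, so the factor X - h(P) cancels. *)
Lemma reg_frac P g : P <> P0 -> reg P g ->
  exists p q : {poly k}, q.[h P] != 0 /\ generic (fun y => g y * q.[h y] = p.[h y]).
Proof.
move=> PP rg; have rh := hreg PP.
have [p [q [q0 E]]] := rational_frac (ex_intro _ P (reg_extends rg)).
have [m mq] := ubnP (size q); elim: m => // m IH in p q q0 E mq *.
have [qP|] := eqVneq q.[h P] 0; last by exists p, q.
have pP : p.[h P] = 0.
  have := @reg_eq_generic _ _ _ Y_curve _ _ _ (regM rg (reg_horner q rh))
    (reg_horner p rh) E.
  by rewrite qP mulr0.
have /factor_theorem [q1 Eq] : root q (h P) by apply/eqP.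
have /factor_theorem [p1 Ep] : root p (h P) by apply/eqP.
have q10 : q1 != 0 by apply: contraNneq q0 => q10; rewrite Eq q10 mul0r.
apply: (IH p1 q1 q10).
  apply: (generic_mono2 E (pole_nonconst (h P))) => y.
  by rewrite Eq Ep !hornerM hornerXsubC mulrA => + h0; apply: mulIf.
by move: mq; rewrite Eq size_Mmonic ?monicXsubC // size_XsubC addn2.
Qed.

(** By [reg_frac], a regular function at P and P' takes there the same value as
    soon as h does; but regular functions separate points. *)
Lemma pole_inj P P' : P <> P0 -> P' <> P0 -> h P = h P' -> P = P'.
Proof.
move=> PP PP' hPP'; apply: contrapT => /reg_separate [g [rg rg' gP /eqP []]].
have [p [q [q0 E]]] := reg_frac PP rg.
have E1 := @reg_eq_generic _ _ _ Y_curve _ _ _ (regM rg (reg_horner q (hreg PP)))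
  (reg_horner p (hreg PP)) E.
have E2 := @reg_eq_generic _ _ _ Y_curve _ _ _ (regM rg' (reg_horner q (hreg
  PP'))) (reg_horner p (hreg PP')) E.
apply: (mulIf q0); rewrite [in LHS]hPP' E2 -hPP' -E1 gP; ring.
Qed.

(** By [reg_frac] the local parameter at P is a fraction p(h) / q(h) with
    q(h(P)) != 0, so it is divisible by h - h(P). *)
Lemma pole_unif P : P <> P0 -> has_order P (fun y => h y - h P) 1.
Proof.
move=> PP; have rt := @reg_param _ _ _ Y_curve P.
have rw : reg P (fun y => h y - h P) by apply: regB; [exact: hreg|exact: reg_cst].
have [|a [ra Ea]] := param_dvd rw; first by rewrite subrr.
have [p [q [q0 E]]] := reg_frac PP rt.
have := @reg_eq_generic _ _ _ Y_curve _ _ _ (regM rt (reg_horner q (hreg PP)))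
  (reg_horner p (hreg PP)) E.
rewrite param0 mul0r => /esym/eqP pP.
have /factor_theorem [p1 Ep] : root p (h P) by [].
exists a; split=> //; apply: contraNneq q0 => aP.
have -> : q.[h P] = a P * p1.[h P].
  apply: (reg_eq_generic (reg_horner q (hreg PP)) (regM ra (reg_horner p1 (hreg
    PP)))).
  apply: (generic_mono3 E Ea (param_neq0 P)) => y;
    rewrite Ep hornerM hornerXsubC => E1 E2 t0.
  by apply: (mulfI t0); rewrite E1 E2; ring.
by rewrite aP mul0r.
Qed.

Lemma param_der_pole_neq0 P : P <> P0 -> param_der P h != 0.
Proof.
move=> PP; have [u [ru uP E]] := pole_unif PP.
by rewrite (@param_derE _ _ _ _ _ _ u).
Qed.

(** The form is locally a sum of a_i d b_i where b_i is a fraction in h, and the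
    quotient rule gives d b_i = s_i d h. *)
Lemma form_local w P : regular_form w -> P <> P0 -> exists A,
  [/\ reg P A, forall d : tangent_space P, w P d = A P * sval d h &
     generic (fun y => forall d : tangent_space y, w y d = A y * sval d h)].
Proof.
move=> /(_ P) [U [m [a [b [Uo UP rab Hw]]]]] PP.
have ra i y : U y -> reg y (a i) by move=> Uy; apply: reg_regular (rab i).1 Uy.
have rb i y : U y -> reg y (b i) by move=> Uy; apply: reg_regular (rab i).2 Uy.
have wit i : exists pq : {poly k} * {poly k},
    pq.2.[h P] != 0 /\ generic (fun y => b i y * pq.2.[h y] = pq.1.[h y]).
  by have [p [q H]] := reg_frac PP (rb i P UP); exists (p, q).
pose p i := (projT1 (cid (wit i))).1; pose q i := (projT1 (cid (wit i))).2.
have W i : (q i).[h P] != 0 /\ generic (fun y => b i y * (q i).[h y] = (p i).[h y]).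
  exact: (projT2 (cid (wit i))).
pose s i y := ((p i)^`().[h y] - b i y * (q i)^`().[h y]) / (q i).[h y].
pose A y := \sum_i a i y * s i y.
have key y (d : tangent_space y) : U y -> y <> P0 -> (forall i, (q i).[h y] != 0) ->
    w y d = A y * sval d h.
  move=> Uy yP qy; rewrite Hw // mulr_suml; apply: eq_bigr => i _; rewrite -mulrA.
  congr (_ * _); have der := svalP d; have rh := hreg yP.
  have rq := reg_horner (q i) rh; have rp := reg_horner (p i) rh.
  have E := @reg_eq_generic _ _ _ Y_curve _ _ _ (regM (rb i y Uy) rq) rp (W i).2.
  have := @der_frac _ _ _ Y_curve _ _ der _ _ _ (rb i y Uy) rq rp E (W i).2.
  rewrite (der_horner (q i) der rh) (der_horner (p i) der rh) => F;
    apply: (mulIf (qy i)); rewrite F /s.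
  by field; exact: qy.
exists A; split.
- apply: reg_sum => i; apply: regM; first exact: ra.
  apply: regM; last by apply: regV (W i).1; apply: reg_horner; exact: hreg.
  apply: regB; first by apply: reg_horner; exact: hreg.
  by apply: regM; [exact: rb|apply: reg_horner; exact: hreg].
- by move=> d; apply: key => // i; exact: (W i).1.
have gq : generic (fun y => forall i, (q i).[h y] != 0).
  apply: generic_forall => i; apply: reg_neq0_generic (W i).1.
  by apply: reg_horner; exact: hreg.
by apply: (generic_mono3 gq (open_generic Uo UP) (generic_neq P0)) => y *;
  apply: key.
Qed.

Lemma form_pole w : regular_form w -> exists A : Y -> k, forall P, P <> P0 ->
  reg P A /\ forall d : tangent_space P, w P d = A P * sval d h.
Proof.
move=> rw; pose A P : k := w P (exist _ (@param_der _ _ _ Y_curve P)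
  (@param_der_derivation _ _ _ Y_curve P)) / @param_der _ _ _ Y_curve P h.
exists A => P PP; have [B [rB EB gB]] := form_local rw PP.
have AB y : y <> P0 -> (forall d : tangent_space y, w y d = B y * sval d h) ->
  B y = A y.
  by move=> yP E; rewrite /A E /= mulfK //; exact: param_der_pole_neq0.
have APB := AB P PP EB; split; last by move=> d; rewrite -APB EB.
by apply: (reg_ext rB) => //; apply: (generic_mono2 gB (generic_neq P0)) =>
  y Ey yP; exact: AB.
Qed.

End SimplePole.

(** Let s = 1 / (h - h(P1)), whose only pole is simple and at P1.  The form is
    both A dh away from P0 and B ds away from P1, so A = - B s^2 has no pole and
    vanishes at P0; being constant, it is zero. *)
Lemma simple_pole_no_form P0 h : (forall x, x <> P0 -> reg x h) ->
  has_order P0 h (-1) ->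
  forall w, regular_form w -> forall y (d : tangent_space y), w y d = 0.
Proof.
move=> hreg hpole w rw.
have [P1 P10] := generic_ex (generic_neq P0); set c := h P1.
have oinv x : x <> P0 -> x <> P1 -> h x - c != 0.
  move=> xP xP1; rewrite subr_eq0; apply/eqP => /(pole_inj hreg hpole xP P10).
  exact: xP1.
have o1 : has_order P1 (fun y => h y - c) 1 by exact: (pole_unif hreg hpole).
have o0 : has_order P0 (fun y => h y - c) (-1).
  have [u [ru ux E]] := hpole.
  exists (fun y => u y - c * param P0 y); split.
  - by apply: regB => //; apply: regZ; exact: reg_param.
  - by rewrite param0 mulr0 subr0.
  apply: (generic_mono2 E (param_neq0 P0)) => y -> t0.
  by rewrite mulrBr mulrCA -invr_expz expr1z mulVf // mulr1.
pose s0 y := (h y - c)^-1.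
have gs x : x <> P1 -> extends_at x s0.
  move=> xP1; have [->|xP0] := pselect (x = P0).
    by apply: has_order_extends (has_orderV o0).
  apply: reg_extends; apply: regV; last exact: oinv.
  by apply: regB; [exact: hreg|exact: reg_cst].
have [|s [Es rs]] := @regularize s0; first by exists P0; apply: gs; exact: nesym.
have sreg x : x <> P1 -> reg x s by move=> /gs /rs.
have spole : has_order P1 s (-1) by apply: has_order_ext Es (has_orderV o1).
have sP0 : s P0 = 0.
  apply: (@has_order_pos_val0 _ _ 0); first by apply: sreg; exact: nesym.
  by have := has_order_ext Es (has_orderV o0); rewrite opprK.
have [A HA] := form_pole hreg hpole rw; have [B HB] := form_pole sreg spole rw.
have AB y : y <> P0 -> y <> P1 -> A y = - B y * s y ^+ 2.
  move=> yP0 yP1; have hc := oinv y yP0 yP1;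
    have der := @param_der_derivation _ _ _ Y_curve y.
  have rh := hreg y yP0; have rsy := sreg y yP1.
  have rhc : reg y (fun z => h z - c) by apply: regB => //; exact: reg_cst.
  have E : generic (fun z => s z * (h z - c) = 1).
    apply: (generic_mono2 Es (pole_nonconst hreg hpole c)) => z <- z0.
    by rewrite /s0 mulVf.
  have Ey := @reg_eq_generic _ _ _ Y_curve _ _ _ (regM rsy rhc) (reg_cst 1 y) E.
  have := @der_frac _ _ _ Y_curve _ _ der _ _ _ rsy rhc (reg_cst 1 y) Ey E.
  rewrite (der_cst der) sub0r (_ : param_der y (fun z => h z - c) =
    param_der y h); last first.
    by apply: etrans (derD der rh (reg_cst (- c) y)) _; rewrite (der_cst der) addr0.
  move=> ds; have := (HA y yP0).2 (exist _ _ der).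
  rewrite ((HB y yP1).2 (exist _ _ der)) /= => F.
  (* From s (h - c) = 1, the derivative of s is - s^2 times that of h. *)
  have dh := param_der_pole_neq0 hreg hpole yP0.
  apply: (mulIf dh); rewrite -F.
  have -> : param_der y s = - s y ^+ 2 * param_der y h.
    apply: (mulIf hc); rewrite ds -[in LHS](mulr1 (s y)) -Ey; ring.
  ring.
have rA2 : reg P0 (fun y => - B y * s y ^+ 2).
  have P01 : P0 <> P1 by exact: nesym.
  by apply: regM; [apply: regN; exact: (HB P0 P01).1|apply: regX; exact: sreg].
have EA : generic (fun y => A y = - B y * s y ^+ 2).
  by apply: (generic_mono2 (generic_neq P0) (generic_neq P1)) => y; exact: AB.
have [|e Ae] := @extends_everywhere_const A.
  move=> x; have [->|xP] := pselect (x = P0); last by apply: reg_extends;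
    exact: (HA x xP).1.
  by exists (fun y => - B y * s y ^+ 2).
have e0 : e = 0.
  rewrite -(reg_eq_generic rA2 (reg_cst e P0)); first by rewrite sP0 expr0n mulr0.
  by apply: (generic_mono2 EA Ae) => y <-.
move: Ae; rewrite e0 => A0 y d.
have [yP|yP] := pselect (y = P0); last first.
  by rewrite (HA y yP).2 (reg_eq_generic (HA y yP).1 (reg_cst 0 y) A0) mul0r.
have yP1 : y <> P1 by rewrite yP; exact: nesym.
rewrite (HB y yP1).2 (reg_eq_generic (HB y yP1).1 (reg_cst 0 y)) ?mul0r //.
apply: (generic_mono3 EA A0 (has_order_neq0 spole)) => z -> /eqP + s0n.
by rewrite mulNr oppr_eq0 mulf_eq0 expf_eq0 /= (negPf s0n) orbF => /eqP.
Qed.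

End RationalCurve.

(** * The projective line *)

Section ProjectiveLine.
Variable k : closedFieldType.
Hypothesis char0 : [pchar k] =i pred0.

Lemma poly_fun_inj (p q : {poly k}) : (forall s, p.[s] = q.[s]) -> p = q.
Proof.
move=> E; apply/eqP; rewrite -subr_eq0; apply: contraT => pq0.
have := @max_poly_roots _ (p - q) [seq i%:R | i <- iota 0 (size (p - q))] pq0.
rewrite size_map size_iota ltnn => H.
have allr : all (root (p - q)) [seq i%:R | i <- iota 0 (size (p - q))].
  by apply/allP => x _; rewrite /root hornerD hornerN E subrr.
have := H allr; apply; rewrite map_inj_uniq ?iota_uniq //.
have natS m : (m.+1)%:R != 0 :> k by have /pcharf0P -> := char0.
move=> i j; wlog ij : i j / (i <= j)%N => [W|].
  by case/orP: (leq_total i j) => /W // H1 /esym /H1.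
move=> /esym/eqP; rewrite -subr_eq0 -natrB //.
by case E2: (j - i)%N => [|m]; [move: E2 ij; lia|rewrite (negPf (natS m))].
Qed.

Notation P1 := (projective_line k).
Implicit Types (z Q : P1).

Lemma ord2_cases (i : 'I_2) : i = ord0 \/ i = ord_max.
Proof. by case: i => -[|[|i]] // H; [left|right]; apply: val_inj. Qed.

Definition pair_coord (s t : k) : 'I_2 -> k := fun i => if i == ord0 then s else t.

Lemma affine_point_ex (s : k) : exists z : P1, exists2 c, c != 0 & 
  forall i, hcoord (val z) i = c * pair_coord s 1 i.
Proof.
pose v : 'rV[k]_2 := \row_i pair_coord s 1 i.
have v0 : v != 0.
  by apply/eqP => /rowP /(_ ord_max) /eqP; rewrite !mxE /pair_coord /= oner_eq0.
have dv : \dim <[v]>%VS == 1%N by rewrite dim_vline v0.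
pose z : projspace k 1 := exist _ <[v]>%VS dv.
have zT : z \in projective_line k by apply: mem_set.
exists (SigSub zT); have := memv_pick <[v]>%VS => /vlineP [c Ec].
exists c; last by move=> i; rewrite /hcoord /= Ec !mxE.
by apply/eqP => c0; move/eqP: Ec; rewrite c0 scale0r vpick0 -dimv_eq0 (eqP dv).
Qed.

Lemma infinite_point_ex : exists z : P1, hcoord (val z) ord_max = 0.
Proof.
pose v : 'rV[k]_2 := \row_i pair_coord 1 0 i.
have v0 : v != 0.
  by apply/eqP => /rowP /(_ ord0) /eqP; rewrite !mxE /pair_coord /= oner_eq0.
have dv : \dim <[v]>%VS == 1%N by rewrite dim_vline v0.
pose z : projspace k 1 := exist _ <[v]>%VS dv.
have zT : z \in projective_line k by apply: mem_set.
exists (SigSub zT); have := memv_pick <[v]>%VS => /vlineP [c Ec].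
by rewrite /hcoord /= Ec !mxE /pair_coord /= mulr0.
Qed.

Lemma projective_line_eq z Q c : (forall i, hcoord (val z) i =
  c * hcoord (val Q) i) -> z = Q.
Proof. by move=> H; apply: val_inj; exact: hcoord_inj H. Qed.

Lemma dehomogenization d (a : {mpoly k[2]}) : a \is d.-homog -> exists p : {poly k},
  [/\ forall s, p.[s] = a.@[pair_coord s 1], (size p <= d.+1)%N & p`_d =
    a.@[pair_coord 1 0]].
Proof.
move=> /dhomogP ah; exists (\sum_(m <- msupp a) a@_m *: 'X^(m ord0)); split.
- move=> s; rewrite horner_sum mevalE; apply: eq_bigr => m _.
  rewrite hornerZ hornerXn; congr (_ * _).
  by rewrite big_ord_recl big_ord1 /pair_coord /= expr1n mulr1.
- rewrite big_seq; apply: (leq_trans (size_sum _ _ _));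
  apply/bigmax_leqP_seq => m ms _.
  apply: (leq_trans (size_scale_leq _ _)); rewrite size_polyXn ltnS.
  by rewrite -(ah m ms) /= mdegE (bigD1 ord0) //= leq_addr.
rewrite coef_sum mevalE big_seq [RHS]big_seq; apply: eq_bigr => m ms.
rewrite coefZ coefXn; congr (_ * _); rewrite -(ah m ms) /= mdegE.
rewrite !big_ord_recl !big_ord0 /pair_coord /= expr1n mul1r mulr1 addn0 expr0n.
by rewrite -[X in _ == X]addn0 eqn_add2l.
Qed.

(** In the affine coordinate the function is locally a fraction.  A root of a
    denominator valid on the whole affine line can be cancelled, so the function is a
    polynomial A; at infinity it is a fraction whose numerator has at most the degree
    of the denominator, so A is constant. *)
Lemma P1_global_const (u : P1 -> k) : regular [set: P1] u ->
  exists c, forall z, u z = c.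
Proof.
move=> ru.
pose pt s : P1 := projT1 (cid (affine_point_ex s)).
have ptP s : exists2 c, c != 0 & forall i, hcoord (val (pt s)) i =
  c * pair_coord s 1 i.
  exact: (projT2 (cid (affine_point_ex s))).
have hev s : exists2 c, c != 0 & forall d a, a \is d.-homog ->
    heval a (val (pt s)) = c ^+ d * a.@[pair_coord s 1].
  have [c c0 E] := ptP s; exists c => // d a ah.
  rewrite -dhomog_mevalZ // /heval; congr (a.@[_]); exact/funext.
pose U s := u (pt s).
(* The factor h vanishes outside the neighbourhood where the fraction is valid,
     so that the identity holds at every affine point. *)
have loc z : exists a b h d e, [/\ a \is d.-homog,
  b \is d.-homog & h \is e.-homog] /\
   [/\ heval h (val z) != 0, heval b (val z) != 0, u z * heval b (val z) =
     heval a (val z) &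
   forall s, h.@[pair_coord s 1] * (U s * b.@[pair_coord s 1]) =
     h.@[pair_coord s 1] * a.@[pair_coord s 1]].
  have [V [d [a [b [[Z [[S [Sh ->]] ->]] /= Vz ah bh H]]]]] := ru z I.
  have [h /not_implyP [Sh_ hz]] : exists h, ~ (S h -> heval h (val z) = 0).
    by apply/existsNP.
  have [e eh] := Sh h Sh_.
  have Hz := H z I Vz.
  exists a, b, h, d, e; do 2![split=> //]; first exact/eqP.
  - by case: Hz.
  - by case: Hz => bz ->; rewrite divfK.
  move=> s; have [hs|hs] := eqVneq h.@[pair_coord s 1] 0;
    first by rewrite hs !mul0r.
  congr (_ * _); have [c c0 E] := hev s; have [|bs] := H (pt s) I.
    by move=> /(_ h Sh_) /eqP; rewrite (E _ _ eh) mulf_eq0 expf_eq0 (negPf c0)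
      andbF (negPf hs).
  rewrite -/(U s) => ->; move: bs; rewrite (E _ _ ah) (E _ _ bh) mulf_eq0 negb_or
    => /andP [cd bs].
  by rewrite -mulf_div divff // mul1r divfK.
have [A HA] : exists A : {poly k}, forall s, U s = A.[s].
  have [a [b [h [d [e [[ah bh hh] [hz bz _ Hab]]]]]]] := loc (pt 0).
  have [pa [Ea _ _]] := dehomogenization ah;
    have [pb [Eb _ _]] := dehomogenization bh.
  have [ph [Eh _ _]] := dehomogenization hh.
  have [c c0 E] := hev 0.
  have B0 : ph * pb != 0.
    apply: contraTneq hz => /(congr1 (horner^~ 0)) /eqP.
    rewrite hornerM horner0 mulf_eq0 Eh Eb (E _ _ hh) => /orP [/eqP ->|/eqP b0].
      by rewrite mulr0 eqxx.
    by move: bz; rewrite (E _ _ bh) b0 mulr0 eqxx.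
  have EB : forall s, U s * (ph * pb).[s] = (ph * pa).[s].
    by move=> s; rewrite !hornerM Eh Eb Ea -Hab mulrCA.
  move: (ph * pb) (ph * pa) B0 EB => B0 A0 {}B0n EB.
  (* A root of the denominator is cancelled: it is a root of the numerator, and
     the quotient remains a valid fraction at the root by comparison with the local one. *)
  have [m Hm] := ubnP (size B0); elim: m => // m IH in B0 A0 B0n EB Hm *.
  have [sB|/closed_rootP [s0 rB]] := eqVneq (size B0) 1%N.
    have /size_poly1P [b0 b0n Eb0] : size B0 == 1%N by apply/eqP.
    exists (b0^-1 *: A0) => s; rewrite hornerZ -EB Eb0 hornerC.
    by rewrite mulrCA mulVf // mulr1.
  have rA : root A0 s0 by rewrite /root -EB (eqP rB) mulr0.
  have /factor_theorem [B1 EB1] := rB; have /factor_theorem [A1 EA1] := rA.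
  have B1n : B1 != 0 by apply: contraNneq B0n => B10; rewrite EB1 B10 mul0r.
  apply: (IH B1 A1 B1n); last first.
    by move: Hm; rewrite EB1 size_Mmonic ?monicXsubC // size_XsubC addn2.
  have off s : s != s0 -> U s * B1.[s] = A1.[s].
    move=> ss0; apply: (@mulIf _ (s - s0)); first by rewrite subr_eq0.
    by have := EB s; rewrite EB1 EA1 !hornerM !hornerXsubC mulrA.
  move=> s; have [->|/off //] := eqVneq s s0.
  have [a' [b' [h' [d' [e' [[ah' bh' hh'] [hz' bz' _ Hab']]]]]]] := loc (pt s0).
  have [pa' [Ea' _ _]] := dehomogenization ah';
    have [pb' [Eb' _ _]] := dehomogenization bh'.
  have [ph' [Eh' _ _]] := dehomogenization hh'.
  have [c' c'0 E'] := hev s0.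
  have hb0 : (ph' * pb').[s0] != 0.
    rewrite hornerM Eh' Eb' mulf_neq0 //.
      by apply: contraNneq hz' => h0; rewrite (E' _ _ hh') h0 mulr0.
    by apply: contraNneq bz' => h0; rewrite (E' _ _ bh') h0 mulr0.
  have EU s' : U s' * (ph' * pb').[s'] = (ph' * pa').[s'].
    by rewrite !hornerM Eh' Eb' Ea' -Hab' mulrCA.
  have P : ('X - s0%:P) * (ph' * pb' * A1) = ('X - s0%:P) * (ph' * pa' * B1).
    apply: poly_fun_inj => s'; rewrite !(hornerM, hornerXsubC).
    have [->|ss0] := eqVneq s' s0; first by rewrite subrr !mul0r.
    have := EU s'; rewrite !hornerM => F; congr (_ * _); rewrite -F -off //; ring.
  move/(mulfI (negbT (polyXsubC_eq0 s0))): P => /(congr1 (horner^~ s0)).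
  rewrite hornerM [in RHS]hornerM -EU => P.
  by apply: (mulfI hb0); rewrite P; ring.
have [Q0 Q0inf] := infinite_point_ex.
have [a [b [h [d [e [[ah bh hh] [hz bz uQ0 Hab]]]]]]] := loc Q0.
have [pa [Ea sa la]] := dehomogenization ah;
  have [pb [Eb sb lb]] := dehomogenization bh.
have [ph [Eh _ lh]] := dehomogenization hh.
have hevinf d' g : g \is d'.-homog -> heval g (val Q0) =
  hcoord (val Q0) ord0 ^+ d' * g.@[pair_coord 1 0].
  move=> gh; rewrite -dhomog_mevalZ // /heval; congr (g.@[_]); apply/funext => i.
  by case: (ord2_cases i) => ->; rewrite /pair_coord /= ?mulr1 ?mulr0.
have pb_d : pb`_d != 0 by apply: contraNneq bz => b0;
  rewrite (hevinf _ _ bh) -lb b0 mulr0.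
have ph0 : ph != 0.
  by apply: contraNneq hz => h0; rewrite (hevinf _ _ hh) -lh h0 coef0 mulr0.
have pb0 : pb != 0 by apply: contraNneq pb_d => ->; rewrite coef0.
have AB : A * pb = pa.
  apply: (mulfI ph0); apply: poly_fun_inj => s.
  by rewrite !hornerM -HA Eh Eb Ea.
have spb : size pb = d.+1.
  by apply/anti_leq; rewrite sb ltnNge; apply: contra pb_d =>
    /leq_sizeP /(_ d (leqnn d)) ->.
(* Comparing degrees at infinity, where the denominator has full degree d. *)
have sA : (size A <= 1)%N.
  have [->|A0] := eqVneq A 0; first by rewrite size_poly0.
  by move: sa; rewrite -AB size_mul // spb addnS /= -[X in (_ <= X)%N]add1n
    leq_add2r.
exists A`_0 => z; have [->|zQ0] := pselect (z = Q0).
  apply: (mulIf bz); rewrite uQ0 (hevinf _ _ ah) (hevinf _ _ bh) -la -lb -AB.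
  by rewrite {1}(size1_polyC sA) coefCM mulrCA.
have z1 : hcoord (val z) ord_max != 0.
  apply/eqP => z1; apply: zQ0; have [i Q0i] := hcoord_neq0 (val Q0).
  have Q00 : hcoord (val Q0) ord0 != 0.
    by case: (ord2_cases i) Q0i => ->//; rewrite Q0inf eqxx.
  apply: (@projective_line_eq _ _ (hcoord (val z) ord0 / hcoord (val Q0) ord0))
    => j.
  by case: (ord2_cases j) => ->; rewrite ?divfK // z1 Q0inf mulr0.
have -> : z = pt (hcoord (val z) ord0 / hcoord (val z) ord_max).
  set s := (X in pt X); have [c c0 E] := ptP s.
  apply: (@projective_line_eq _ _ (hcoord (val z) ord_max / c)) => i;
    rewrite E mulrA divfK //.
  by case: (ord2_cases i) => ->; rewrite /pair_coord /= ?mulr1 // /s mulrC divfK.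
by rewrite -/(U _) HA (size1_polyC sA) hornerC coefC.
Qed.

Definition vanishing_form Q : {mpoly k[2]} :=
  hcoord (val Q) ord_max *: 'X_ord0 - hcoord (val Q) ord0 *: 'X_ord_max.

Lemma vanishing_form_homog Q : vanishing_form Q \is 1.-homog.
Proof. by apply: rpredB; apply: rpredZ; rewrite dhomogX /= mdeg1. Qed.

Lemma heval_vanishing_form Q z : heval (vanishing_form Q) (val z) =
  hcoord (val Q) ord_max * hcoord (val z) ord0 - hcoord (val Q) ord0 * hcoord
    (val z) ord_max.
Proof. by rewrite /heval mevalB !mevalZ !mevalXU. Qed.

Lemma vanishing_form_eq0 Q z : heval (vanishing_form Q) (val z) = 0 <-> z = Q.
Proof.
rewrite heval_vanishing_form; split=> [/eqP|->]; last by rewrite mulrC subrr.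
rewrite subr_eq0 => /eqP E; have [j Qj] := hcoord_neq0 (val Q).
apply: (@projective_line_eq _ _ (hcoord (val z) j / hcoord (val Q) j)) => i;
  apply: (mulfI Qj).
rewrite [RHS](_ : _ = hcoord (val z) j * hcoord (val Q) i); last by field.
case: (ord2_cases i) => ->; case: (ord2_cases j) => ->;
  [exact: mulrC| | |exact: mulrC].
  by rewrite E mulrC.
by rewrite -E mulrC.
Qed.

Lemma P1_open_neq Q : zariski_open [set z : P1 | z <> Q].
Proof.
exists [set val Q]; split; first exact: zariski_closed1.
by rewrite eqEsubset; split=> z /= H; [move/val_inj|move=> zQ; apply: H;
  rewrite zQ].
Qed.

(** The coordinate with its zero at Q and its pole at Q'. *)
Definition zeta Q Q' z : k := heval (vanishing_form Q) (val z) / heval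
  (vanishing_form Q') (val z).

Lemma zeta_regular Q Q' : regular [set z : P1 | z <> Q'] (zeta Q Q').
Proof.
move=> z zQ; exists [set z : P1 | z <> Q'], 1%N, (vanishing_form Q),
  (vanishing_form Q'); split=> //.
- exact: P1_open_neq.
- exact: vanishing_form_homog.
- exact: vanishing_form_homog.
by move=> y yQ _; split=> //; apply/eqP => /vanishing_form_eq0.
Qed.

Lemma zeta_neq0 Q Q' z : z <> Q -> z <> Q' -> zeta Q Q' z != 0.
Proof.
move=> zQ zQ'; rewrite mulf_neq0 ?invr_eq0 //;
  first by apply/eqP => /vanishing_form_eq0.
by apply/eqP => /vanishing_form_eq0.
Qed.

Lemma zeta0 Q Q' : zeta Q Q' Q = 0.
Proof. by rewrite /zeta (_ : heval _ _ = 0) ?mul0r //;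
  apply/vanishing_form_eq0. Qed.

End ProjectiveLine.

(** * Torsion differences of points *)

Section Key.
Variables (k : closedFieldType) (n : nat) (Y : set (projspace k n)).
Context {Y_curve : nonsingular_projective_curve Y}.
Hypothesis char0 : [pchar k] =i pred0.
Hypothesis global_const : forall f : Y -> k, (forall x, reg x f) ->
  exists c, forall y, f y = c.
Implicit Types (x y z P : Y) (f g u h : Y -> k).

(** Each increase of the allowed pole order by one adds at most one function,
    and the step from 0 to 1 adds none when no pole is simple. *)
Lemma small_linear_system P0 m :
  ~ (exists h, (forall x, x <> P0 -> reg x h) /\ has_order P0 h (-1)) ->
  exists phi : 'I_m.+1 -> Y -> k, (forall i, rational (phi i)) /\
  forall f, (forall x, x <> P0 -> extends_at x f) -> order_ge P0 (- m.+1%:Z) f ->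
    exists c : 'I_m.+1 -> k, generic (fun y => f y = \sum_i c i * phi i y).
Proof.
move=> noh; have [P1 P10] := generic_ex (generic_neq P0).
elim: m => [|m [phi [rphi Hphi]]].
  exists (fun _ _ => 1); split=> [_|f gf vf]; first by exists P0;
    exact: extends_at_cst.
  have [|c fc] := @extends_everywhere_const _ _ _ _ global_const f.
    move=> x; have [->|/gf//] := pselect (x = P0).
    case: (order_geE vf) => [f0|[j j1 oj]].
      by exists (fun=> 0); split=> //; exact: reg_cst.
    have [j0|j0] := leP 0 j; first exact: has_order_extends oj.
    have Ej : j = -1 by lia.
    have [|h [E rh]] := @regularize _ _ _ _ f; first by exists P1; exact: gf.
    case: noh; exists h; split=> [y /gf /rh //|].
    by apply: has_order_ext E _; rewrite -Ej.
  exists (fun=> c); apply: (generic_mono fc) => y ->.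
  by rewrite big_ord1 mulr1.
(* The new function is zero when no function has a pole of order exactly m + 2. *)
have [psi [rpsi Hpsi]] : exists psi, rational psi /\
   forall f, (forall x, x <> P0 -> extends_at x f) -> order_ge P0 (- m.+2%:Z) f ->
   exists c, order_ge P0 (- m.+1%:Z) (fun y => f y - c * psi y) /\
     forall x, x <> P0 -> extends_at x (fun y => f y - c * psi y).
  have [[psi [gpsi opsi]]|nopsi] := pselect (exists psi,
      (forall x, x <> P0 -> extends_at x psi) /\ has_order P0 psi (- m.+2%:Z)).
    exists psi; split=> [|f gf vf]; first by exists P1; exact: gpsi.
    have greg_sub c x : x <> P0 -> extends_at x (fun y => f y - c * psi y).
      move=> xP; apply: extends_at_ext (extends_atD (gf x xP) (extends_atM
        (extends_at_cst x (- c)) (gpsi x xP))).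
      by apply: generic_all => y; rewrite mulNr.
    have vge_sub0 i : order_ge P0 i f -> order_ge P0 i (fun y => f y - 0 * psi y).
      by apply: order_ge_ext; apply: generic_all => y; rewrite mul0r subr0.
    case: (order_geE vf) => [f0|[j jm oj]].
      exists 0; split; last exact: greg_sub.
      apply: vge_sub0; exists (fun=> 0); split; first exact: reg_cst.
      by apply: (generic_mono f0) => y ->; rewrite mulr0.
    have [jm'|jm'] := leP (- m.+1%:Z) j.
      by exists 0; split; [apply: vge_sub0; exact: has_order_ge oj|exact: greg_sub].
    have Ej : j = - m.+2%:Z by lia.
    rewrite -Ej in opsi; have [c [_ vc]] := has_order_cancel oj opsi.
    exists c; split; last exact: greg_sub.
    by move: vc; rewrite Ej (_ : - m.+2%:Z + 1 = - m.+1%:Z) //; lia.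
  exists (fun=> 0); split=> [|f gf vf]; first by exists P0; exact: extends_at_cst.
  exists 0; split=> [|x xP]; last first.
    by apply: extends_at_ext (gf x xP); apply: generic_all => y;
      rewrite mulr0 subr0.
  apply: (@order_ge_ext _ _ _ _ _ f); first by apply: generic_all => y;
    rewrite mulr0 subr0.
  case: (order_geE vf) => [f0|[j jm oj]].
    exists (fun=> 0); split; first exact: reg_cst.
    by apply: (generic_mono f0) => y ->; rewrite mulr0.
  apply: (has_order_ge _ oj); have [//|jm'] := leP (- m.+1%:Z) j.
  case: nopsi; exists f; split=> //.
  by rewrite (_ : - m.+2%:Z = j) //; lia.
exists (fun i => if unlift ord0 i is Some j then phi j else psi); split.
  by move=> i; case: (unlift ord0 i).
move=> f gf vf; have [c [vc gc]] := Hpsi f gf vf.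
have [c' Ec'] := Hphi _ gc vc.
exists (fun i => if unlift ord0 i is Some j then c' j else c).
apply: (generic_mono Ec') => y E; rewrite big_ord_recl unlift_none.
under eq_bigr do rewrite liftK.
by rewrite -E addrC subrK.
Qed.

(** A nonzero form excludes a function with a single simple pole; hence the linear
    system is spanned by M = m + 1 functions, and at a general P none of its nonzero
    members vanishes to order M. *)
Lemma finite_torsion P0 m w (y0 : Y) (d0 : tangent_space y0) :
  regular_form w -> w y0 d0 != 0 ->
  generic (fun P => ~ exists f, [/\ forall x, x <> P0 ->
    extends_at x f, order_ge P0 (- m.+1%:Z) f,
    order_ge P m.+1%:Z f & ~ generic (fun y => f y = 0)]).
Proof.
move=> rw w0; have [[h [hreg hpole]]|noh] := pselect
   (exists h, (forall x, x <> P0 -> reg x h) /\ has_order P0 h (-1)).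
  by case/eqP: w0; exact: simple_pole_no_form hreg hpole w rw y0 d0.
have [phi [rphi Hphi]] := @small_linear_system P0 m noh.
have [D gD] := derivation_ex P0.
apply: (generic_mono (general_vanishing char0 gD rphi)) => P HP [f [gf vf vP nf]].
have [c Ec] := Hphi f gf vf; apply: nf.
by apply: (generic_mono2 Ec (HP c (order_ge_ext Ec vP))) => y ->.
Qed.

End Key.

(** * Functions on a quotient *)

Section Quotient.
Variables (k : closedFieldType) (n : nat) (Y : set (projspace k n)).
Context {Y_curve : nonsingular_projective_curve Y}.
Hypothesis char0 : [pchar k] =i pred0.
Variables (gT : finGroupType) (G : {group gT}) (act : action G Y).
Hypothesis act_alg : algebraic_action act.
Variable pi : Y -> projective_line k.
Hypothesis pi_quotient : quotient_map act pi.
Implicit Types (x y z P : Y) (f g u h : Y -> k) (Q : projective_line k).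

Lemma act_axiom : is_action G act.
Proof. by case: act. Qed.

Lemma act_groupM x a b : a \in G -> b \in G -> act x (a * b)%g = act (act x a) b.
Proof. by move=> aG bG; have [_ H] := act_axiom; exact: H. Qed.

Lemma act_injective a : injective (act^~ a).
Proof. by have [H _] := act_axiom; exact: H. Qed.

Lemma act_id x : act x 1%g = x.
Proof. by apply: (@act_injective 1%g); rewrite /= -act_groupM ?mulg1 // group1. Qed.

Lemma setT_open : zariski_open [set: Y].
Proof. by apply: generic_open; apply: generic_all. Qed.

Lemma reg_act f a x : a \in G -> reg (act x a) f -> reg x (fun y => f (act y a)).
Proof.
move=> aG /regP [U [Uo Ux rU]]; have [Vo rV] := act_alg aG Uo.
by apply: (reg_regular Vo (rV _ rU)).
Qed.

Lemma generic_act (S : Y -> Prop) a : generic S -> generic (fun y => S (act y a)).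
Proof.
move=> gS; apply: (@finite_preimage _ _ [set y | ~ S y] (fun y => act y a)) => //.
by move=> y z _ _; exact: act_injective.
Qed.

Lemma fibre_generic Q : generic (fun y => pi y <> Q).
Proof.
have [pi_mor pi_surj _ _ _] := pi_quotient.
have [Uo _] := pi_mor _ (@P1_open_neq k Q).
have [Q' Q'Q] : exists Q' : projective_line k, Q' <> Q.
  have [z [c c0 Hz]] := affine_point_ex (0 : k);
    have [z' Hz'] := infinite_point_ex k.
  have zz' : z <> z'.
    move=> E; have := Hz ord_max; rewrite E Hz' /pair_coord /= mulr1 => /esym /eqP.
    by rewrite (negPf c0).
  have [zQ|] := pselect (z = Q); last by exists z.
  by exists z' => z'Q; apply: zz'; rewrite zQ z'Q.
have [y Ey] := pi_surj Q'.
by apply: (@open_generic _ _ _ _ (pi @^-1` [set z | z <> Q]) y) => //;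
  rewrite /= Ey.
Qed.

Lemma reg_zeta Q Q' y : pi y <> Q' -> reg y (fun z => zeta Q Q' (pi z)).
Proof.
have [pi_mor _ _ _ _] := pi_quotient; have [Uo rU] := pi_mor _ (@P1_open_neq k Q').
move=> yQ; exact: reg_regular Uo (rU _ (@zeta_regular k Q Q')) yQ.
Qed.

(** Each factor is generically zero or generically nonzero. *)
Lemma generic_prod_eq0 (I : finType) (F : I -> Y ->
  k) x : (forall i, reg x (F i)) ->
  generic (fun y => \prod_i F i y = 0) -> exists i, generic (fun y => F i y = 0).
Proof.
move=> rF g0; apply: contrapT => no.
have gn i : generic (fun y => F i y != 0).
  by case: (reg_zero_or_neq0 (rF i)) => // gi; case: no; exists i.
have gall : generic (fun y => forall j : 'I_#|I|, F (enum_val j) y != 0).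
  by apply: generic_forall => j; exact: gn.
have [y [/eqP]] := generic_ex (generic_mono2 g0 gall (fun y => @conj _ _)).
move=> /prodf_eq0 [i _ Fi] /(_ (enum_rank i)).
by rewrite enum_rankK Fi.
Qed.

(** The norm of f - f(y0) descends to a regular function on the line, hence
    is constant, and it vanishes at y0; so some conjugate of f is generically equal
    to f(y0). *)
Lemma quotient_global_const f : (forall x, reg x f) -> exists c, forall y, f y = c.
Proof.
move=> rf; have [pi_mor pi_surj pi_fib _ pi_inv] := pi_quotient.
have regf a x : a \in G -> reg x (fun y => f (act y a)) by move=> aG;
  exact: reg_act.
have To : zariski_open [set: projective_line k].
  exists set0; split; first exact: zariski_closed0.
  by rewrite eqEsubset; split=> z /= _ => [[]|].

have rGprod c x : reg x (fun y => \prod_(a in G) (f (act y a) - c)).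
  under eq_fun do rewrite big_mkcond /=.
  apply: reg_prod => a; case aG: (a \in G); last exact: reg_cst.
  by apply: regB; [exact: regf|exact: reg_cst].
have inv c y b : b \in G -> \prod_(a in G) (f (act (act y b) a) - c) =
  \prod_(a in G) (f (act y a) - c).
  move=> bG; rewrite [RHS](reindex_inj (mulgI b)) /=.
  by apply: eq_big => a; rewrite ?groupMl // => aG; rewrite act_groupM.
have desc c : exists v : projective_line k ->
  k, regular [set: projective_line k] v /\
    forall y, \prod_(a in G) (f (act y a) - c) = v (pi y).
  have [||u [ru Eu]] := pi_inv setT (fun y => \prod_(a in G) (f (act y a) - c)) To.
  - by apply: regular_reg => //; exact: setT_open.
  - by move=> y b _ bG; exact: inv.
  by exists u; split=> // y; apply: Eu.
have [y0 _] := generic_ex (@generic_all _ _ Y (fun=> True) (fun=> I)).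
have [u [ru Eu]] := desc (f y0); have [d Hd] := P1_global_const char0 ru.
have d0 : d = 0.
  by rewrite -(Hd (pi y0)) -Eu (bigD1 1%g) //= act_id subrr mul0r.
pose F a y := if a \in G then f (act y a) - f y0 else 1.
have [||a Ha] := @generic_prod_eq0 _ F y0.
- move=> a; rewrite /F; case aG: (a \in G); last exact: reg_cst.
  by apply: regB; [exact: regf|exact: reg_cst].
- by apply: generic_all => y; rewrite -big_mkcond /= Eu Hd.
case aG: (a \in G); last first.
  by have [y /eqP] := generic_ex Ha; rewrite /F aG oner_eq0.
exists (f y0) => z; rewrite -[z](act_id z) -(mulVg a) act_groupM ?groupV //.
set z' := act z _.
apply: (reg_eq_generic (regf a z' aG) (reg_cst (f y0) z')).
by apply: (generic_mono Ha) => y; rewrite /F aG => /eqP; rewrite subr_eq0 => /eqP.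
Qed.

End Quotient.

(** * Units on the complement of a fibre *)

Section Units.
Variables (k : closedFieldType) (n : nat) (Y : set (projspace k n)).
Context {Y_curve : nonsingular_projective_curve Y}.
Hypothesis char0 : [pchar k] =i pred0.
Variables (gT : finGroupType) (G : {group gT}) (act : action G Y).
Hypothesis act_alg : algebraic_action act.
Variable pi : Y -> projective_line k.
Hypothesis pi_quotient : quotient_map act pi.
Implicit Types (x y z P : Y) (f g u h : Y -> k) (Q : projective_line k).

Lemma pi_act x a : a \in G -> pi (act x a) = pi x.
Proof. by move=> aG; have [_ _ H _ _] := pi_quotient; apply/esym/H; exists a. Qed.

Lemma act_cancel x a : a \in G -> act (act x a) a^-1%g = x.
Proof. by move=> aG; rewrite -act_groupM ?groupV // mulgV act_id. Qed.

(** Composing with the automorphism and its inverse shows that the two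
    parameters divide each other. *)
Lemma param_act x a : a \in G -> has_order x (fun y => param (act x a) (act y a)) 1.
Proof.
move=> aG; set z := act x a.
have rt : reg x (fun y => param z (act y a)) by apply: reg_act => //;
  exact: reg_param.
have [|w [rw Ew]] := param_dvd rt; first by rewrite param0.
have aG' : a^-1%g \in G by rewrite groupV.
have rt' : reg z (fun y => param x (act y a^-1%g)).
  by apply: (reg_act act_alg) => //; rewrite /z act_cancel //; exact: reg_param.
have [|w' [rw' Ew']] := param_dvd rt'; first by rewrite /z act_cancel // param0.
exists w; split=> //.
have rw'a : reg x (fun y => w' (act y a)) by exact: reg_act.
have E : w x * w' (act x a) = 1.
  apply: (reg_eq_generic (regM rw rw'a) (reg_cst 1 x)).
  apply: (generic_mono3 Ew (generic_act act a Ew') (param_neq0 x)) => y E1;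
    rewrite act_cancel // => E2 t0.
  by apply: (mulfI t0); rewrite mulr1 mulrA -E1 -E2.
by apply/eqP => wx; move/eqP: E; rewrite wx mul0r eq_sym oner_eq0.
Qed.

Lemma has_order_act x f a (i : int) : a \in G -> has_order (act x a) f i ->
  has_order x (fun y => f (act y a)) i.
Proof.
move=> aG [u [ru ux E]].
have ru' : reg x (fun y => u (act y a)) by exact: reg_act.
have := has_orderM (has_orderXz i (param_act x aG)) (reg_has_order0 ru' ux);
  rewrite mul1r addr0.
by apply: has_order_ext; apply: (generic_mono (generic_act act a E)) => y ->.
Qed.

Lemma has_order_prod x m (F : 'I_m -> Y -> k) (e : 'I_m ->
  int) : (forall l, has_order x (F l) (e l)) ->
  has_order x (fun y => \prod_l F l y) (\sum_l e l).
Proof.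
elim: m F e => [|m IH] F e H.
  rewrite big_ord0; apply: has_order_ext (has_order_cst x (oner_neq0 k)).
  by apply: generic_all => y; rewrite big_ord0.
rewrite big_ord_recl; apply: has_order_ext (has_orderM (H ord0) (IH _ _ (fun l =>
  H (lift ord0 l)))).
by apply: generic_all => y; rewrite big_ord_recl.
Qed.

Variables (p : nat) (p_prime : prime p) (sigma : gT).
Hypotheses (G_cyclic : G = <[sigma]>%g :> {set gT}) (G_order : #|G| = p).

Definition translate i x := act x (sigma ^+ i)%g.

Lemma sigmaG i : (sigma ^+ i)%g \in G.
Proof. by rewrite G_cyclic mem_cycle. Qed.

Lemma translateD i j x : translate j (translate i x) = translate (i + j) x.
Proof. by rewrite /translate -act_groupM ?sigmaG // expgD. Qed.

Lemma translate_dvd i x : (p %| i)%N -> translate i x = x.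
Proof.
have op_ : #[sigma]%g = p by rewrite -G_order G_cyclic.
by rewrite -op_ order_dvdn /translate => /eqP ->; exact: act_id.
Qed.

Lemma pi_translate i x : pi (translate i x) = pi x.
Proof. exact/pi_act/sigmaG. Qed.

Lemma fibre_translate x P : pi x = pi P -> exists i, x = translate i P.
Proof.
have [_ _ H _ _] := pi_quotient; move=> /esym /H [a aG ->].
have /cycleP [i ->] : a \in <[sigma]>%g by rewrite -G_cyclic.
by exists i.
Qed.

Definition zeta_pi Q Q' y := zeta Q Q' (pi y).

Lemma has_order_zeta_pi0 Q Q' x : pi x <> Q -> pi x <> Q' ->
  has_order x (zeta_pi Q Q') 0.
Proof.
move=> xQ xQ'; apply: reg_has_order0; first exact: (reg_zeta pi_quotient).
exact: zeta_neq0.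
Qed.

Lemma has_order_zeta_pi_translate Q Q' P (e : int) i : has_order P (zeta_pi Q Q')
  e -> has_order (translate i P) (zeta_pi Q Q') e.
Proof.
move=> oP; have E : act (translate i P) (sigma ^+ i)^-1%g =
  P by rewrite /translate act_cancel // sigmaG.
have aG : (sigma ^+ i)^-1%g \in G by rewrite groupV sigmaG.
rewrite -E in oP; apply: has_order_ext (has_order_act aG oP).
by apply: generic_all => y; rewrite /zeta_pi pi_act.
Qed.

(** The pullback vanishes at P without being generically zero. *)
Lemma has_order_zeta_pi_pos Q Q' P : Q <> Q' -> pi P = Q ->
  exists e : nat, has_order P (zeta_pi Q Q') (e.+1)%:Z.
Proof.
move=> QQ' PQ; have rz : reg P (zeta_pi Q Q') by apply: (reg_zeta pi_quotient);
  rewrite PQ.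
have z0 : zeta_pi Q Q' P = 0 by rewrite /zeta_pi PQ zeta0.
case: (extends_at_order (reg_extends rz)) => [g0|[[|e] oe]]; last by exists e.
  have [y [[yQ yQ'] /eqP]] := generic_ex (generic_mono2 (generic_mono2
    (fibre_generic pi_quotient Q)
    (fibre_generic pi_quotient Q') (fun y => @conj _ _)) g0 (fun y => @conj _ _)).
  by rewrite (negPf (zeta_neq0 yQ yQ')).
have [u [ru uP E]] := oe; case/eqP: uP; rewrite -z0; apply/esym.
apply: (reg_eq_generic rz ru); apply: (generic_mono E) => y ->.
by rewrite mul1r.
Qed.

Lemma zeta_pi_mul Q Q1 Q2 : generic (fun y => zeta_pi Q Q1 y * zeta_pi Q1 Q2 y =
  zeta_pi Q Q2 y).
Proof.
apply: (generic_mono (fibre_generic pi_quotient Q1)) => y yQ1;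
  rewrite /zeta_pi /zeta mulrA divfK //.
by apply/eqP => /vanishing_form_eq0.
Qed.

Lemma zeta_pi_inv Q Q1 y : (zeta_pi Q1 Q y)^-1 = zeta_pi Q Q1 y.
Proof. by rewrite /zeta_pi /zeta invf_div. Qed.

(** For d = (m, c, e), some rational function has divisor (m + 1) P + c (sum of the
    orbit of P), and e + 1 is the ramification index at P, measured with the
    coordinate whose pole is at Q0. *)
Definition exceptional (Q0 : projective_line k) (d : nat * int * nat) Q :=
  exists P g,
  [/\ pi P = Q,
      forall i, has_order (translate i P) g ((d.1.1.+1)%:Z * (p %| i)%:R + d.1.2),
      forall x, pi x <> Q -> has_order x g 0 &
      has_order P (zeta_pi Q Q0) (d.2.+1)%:Z].

(** Two exceptional points Q, Q' with the same triple give
    f = (g / g')^(e + 1) zeta^(- c), where zeta is the pullback of the coordinate with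
    zero Q and pole Q': along the orbits the contributions of c cancel, and the
    divisor of f is (m + 1)(e + 1)(P - P'). *)
Lemma exceptional_finite w (y0 : Y) (d0 : tangent_space y0) Q0 d :
  regular_form w -> w y0 d0 != 0 ->
  finite_set [set Q | Q <> Q0 /\ exceptional Q0 d Q].
Proof.
move=> rw w0; case: d => [[m c] e] /=.
have [[Q' [Q'Q0 [P' [g' [P'Q' og' og'0 oz']]]]]|no] :=
  pselect (exists Q, Q <> Q0 /\ exceptional Q0 (m, c, e) Q);
  last first.
  by apply: sub_finite_set (finite_set0 _) => Q [QQ0 eQ]; apply: no; exists Q.
rewrite /= in og' oz'.
have global := @quotient_global_const _ _ _ Y_curve char0 _ _ _ act_alg _
  pi_quotient.
pose M := (m.+1 * e.+1).-1; have EM : M.+1%:Z =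
  (m.+1)%:Z * (e.+1)%:Z :> int by rewrite /M; lia.
have fin := @finite_torsion _ _ _ Y_curve char0 global P' M _ _ _ rw w0.
apply: (@sub_finite_set _ _ ([set Q'] `|` (pi @` [set P | ~ ~ exists f,
    [/\ forall x, x <> P' -> extends_at x f, order_ge P' (- M.+1%:Z) f,
    order_ge P M.+1%:Z f & ~ generic (fun y => f y = 0)]]))); last first.
  by rewrite finite_setU; split; [exact: finite_set1|exact: finite_image].
move=> Q [QQ0 [P [g [PQ og og0 oz]]]] /=; rewrite /= in og oz.
have [->|QQ'] := pselect (Q = Q'); [by left|right].
exists P => // nf; apply: nf.
pose f y := (g y / g' y) ^ (e.+1)%:Z * zeta_pi Q Q' y ^ (- c).
have ozQ i : has_order (translate i P) (zeta_pi Q Q') (e.+1)%:Z.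
  have o0 : has_order (translate i P) (zeta_pi Q0 Q') 0.
    by apply: has_order_zeta_pi0; rewrite pi_translate PQ.
  have := has_orderM (has_order_zeta_pi_translate i oz) o0; rewrite addr0.
  by apply: has_order_ext; exact: zeta_pi_mul.
have ozQ' i : has_order (translate i P') (zeta_pi Q Q') (- (e.+1)%:Z).
  have o0 : has_order (translate i P') (zeta_pi Q0 Q) 0.
    by apply: has_order_zeta_pi0; rewrite pi_translate P'Q' //; exact: nesym.
  have := has_orderV (has_order_ext (zeta_pi_mul Q' Q0 Q) (has_orderM
    (has_order_zeta_pi_translate i oz') o0)); rewrite addr0.
  by apply: has_order_ext; apply: generic_all => y; exact: zeta_pi_inv.
have off i : has_order (translate i P) f ((m.+1)%:Z * (e.+1)%:Z * (p %| i)%:R).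
  have o' : has_order (translate i P) g' 0 by apply: og'0; rewrite pi_translate PQ.
  have := has_orderM (has_orderXz (e.+1)%:Z (has_orderM (og i) (has_orderV o')))
    (has_orderXz (- c) (ozQ i)).
  by congr (has_order _ _ _); ring.
have off' i : has_order (translate i P') f (- ((m.+1)%:Z * (e.+1)%:Z * (p %|
  i)%:R)).
  have o' : has_order (translate i P') g 0 by apply: og0;
    rewrite pi_translate P'Q'; exact: nesym.
  have := has_orderM (has_orderXz (e.+1)%:Z (has_orderM o' (has_orderV (og' i))))
    (has_orderXz (- c) (ozQ' i)).
  by congr (has_order _ _ _); ring.
exists f; split.
- move=> x xP'; have [/fibre_translate [i xi]|xQ] := pselect (pi x = pi P).
    by rewrite xi; apply: has_order_extends (off i); rewrite mulr_ge0 // ler0n.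
  have [/fibre_translate [i xi]|xQ'] := pselect (pi x = pi P').
    have pi_ : (p %| i)%N = false.
      by apply/negP => /translate_dvd E; apply: xP'; rewrite xi E.
    by have := off' i; rewrite xi pi_ mulr0 oppr0; exact: has_order_extends.
  rewrite PQ in xQ; rewrite P'Q' in xQ'.
  have := has_orderM (has_orderXz (e.+1)%:Z (has_orderM (og0 x xQ) (has_orderV
    (og'0 x xQ')))) (has_orderXz (- c) (has_order_zeta_pi0 xQ xQ')).
  by rewrite subr0 !mul0r addr0; exact: has_order_extends.
- have := off' 0%N; rewrite translate_dvd // dvdn0 mulr1 -EM; exact: has_order_ge.
- have := off 0%N; rewrite translate_dvd // dvdn0 mulr1 -EM; exact: has_order_ge.
move=> f0; have := has_order_neq0 (off 0%N) => fn.
by have [y [/eqP ->]] := generic_ex (generic_mono2 f0 fn (fun y => @conj _ _)).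
Qed.

(** If the orders of f along the fibre are all equal, f or its inverse has no
    pole.  This includes the ramified case, where the fibre is one point. *)
Lemma unit_exceptional Q0 Q f : Q <> Q0 -> regular_unit [set y | pi y <> Q] f ->
  (exists c, forall y, pi y <> Q -> f y = c) \/ exists d, exceptional Q0 d Q.
Proof.
move=> QQ0 [rf [u [ru fu]]].
have global := @quotient_global_const _ _ _ Y_curve char0 _ _ _ act_alg _
  pi_quotient.
have [pi_mor pi_surj _ _ _] := pi_quotient; have [Xo _] :=
  pi_mor _ (@P1_open_neq k Q).
have rfX x : pi x <> Q -> reg x f by move=> xQ; apply: reg_regular Xo rf xQ.
have fX x : pi x <> Q -> f x != 0.
  by move=> /fu E; apply/eqP => f0; move/eqP: E; rewrite f0 mul0r eq_sym oner_eq0.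
have o0 x : pi x <> Q -> has_order x f 0 by move=> xQ; apply: reg_has_order0;
  [exact: rfX|exact: fX].
have [P PQ] := pi_surj Q; have [x0 x0Q] := generic_ex (fibre_generic pi_quotient Q).
have ord x : exists i, has_order x f i.
  case: (rational_order (ex_intro _ x0 (reg_extends (rfX x0 x0Q)))) => [f0|];
    last exact.
  have [y [/eqP]] := generic_ex (generic_mono2 f0 (has_order_neq0 (o0 _ x0Q))
    (fun y => @conj _ _)).
  by move=> /eqP ->; rewrite eqxx.
pose a i := projT1 (cid (ord (translate i P))).
have oa i : has_order (translate i P) f (a i) by exact: (projT2 (cid (ord
  (translate i P)))).
have aper i : a (i + p)%N = a i.
  apply: (has_order_uniq (oa _)); have -> : translate (i + p) P = translate i P;
    last exact: oa.
  by rewrite -translateD translate_dvd.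
have const h : (forall x, pi x <> Q -> has_order x h 0) ->
  (forall i, exists2 j, 0 <= j & has_order (translate i P) h j) ->
    exists c, generic (fun y => h y = c).
  move=> h0 hj; apply: (extends_everywhere_const global) => x;
    have [xQ|xQ] := pselect (pi x = Q).
    by have [|i ->] := @fibre_translate x P; [rewrite PQ|have [j j0 oj] := hj i;
      exact: has_order_extends oj].
  exact: has_order_extends (h0 x xQ).
have final c : generic (fun y => f y = c) -> exists c, forall y, pi y <> Q ->
  f y = c.
  by move=> fc; exists c => y yQ; apply: (reg_eq_generic (rfX y yQ) (reg_cst c y)).
have [ac|/existsNP [i0 ai0]] := pselect (forall i, a i = a 0%N).
  left; have [a0|a0] := leP 0 (a 0%N).
    have [|c fc] := const f o0; last exact: final fc.
    by move=> i; exists (a i); [rewrite ac|exact: oa].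
  have [||c fc] := const (fun y => (f y)^-1).
  - by move=> x xQ; rewrite -oppr0; apply: has_orderV; exact: o0.
  - by move=> i; exists (- a i); [rewrite ac oppr_ge0 ltW|apply: has_orderV;
    exact: oa].
  by apply: (final c^-1); apply: (generic_mono fc) => y <-; rewrite invrK.
right; have [F [m [c EF]]] := cyclic_inverse p_prime aper (ex_intro _ i0 ai0).
have [e oe] := has_order_zeta_pi_pos QQ0 PQ.
exists (m, c, e), P, (fun y => \prod_(l < size F) f (translate l y) ^ F`_l);
  split; [exact: PQ|move=> i /=|move=> x xQ|exact: oe].
  rewrite -EF /shift_op; apply: has_order_prod => l; rewrite mulrC.
  have H : has_order (translate i P) (fun y => f (translate l y)) (a (i + l)%N).
    apply: has_order_act; first exact: sigmaG.
    by rewrite -/(translate l (translate i P)) translateD; exact: oa.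
  exact: has_orderXz H.
have E : \sum_(l < size F) 0 * F`_l = 0 by apply: big1 => l _; exact: mul0r.
rewrite -[X in has_order _ _ X]E; apply: has_order_prod => l.
have H : has_order x (fun y => f (translate l y)) 0.
  apply: has_order_act; first exact: sigmaG.
  by rewrite -/(translate l x); apply: o0; rewrite pi_translate.
exact: has_orderXz H.
Qed.

Lemma nonzero_form (g : nat) : has_genus Y g -> (0 < g)%N ->
  exists w (y : Y) (d : tangent_space y), regular_form w /\ w y d != 0.
Proof.
move=> [w [rw indep _]] g0; pose i0 := Ordinal g0; apply: contrapT => no.
(* If all forms of the basis vanished, the first one would give a linear relation. *)
have H : forall y (D : tangent_space y), \sum_(i < g) (i == i0)%:R * w i y D = 0.
  move=> y D; rewrite (bigD1 i0) //= ?eqxx ?mul1r big1 => [|i /negPf ->];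
    last by rewrite mul0r.
  rewrite addr0; apply/eqP; apply: contrapT => /negP wD.
  by apply: no; exists (w i0), y, D.
by have /eqP := indep _ H i0; rewrite eqxx oner_eq0.
Qed.

Lemma const_regular_unit Q f c : c != 0 -> (forall y, pi y <> Q -> f y = c) ->
  regular_unit [set y | pi y <> Q] f.
Proof.
move=> c0 fc; have [pi_mor _ _ _ _] := pi_quotient;
  have [Xo _] := pi_mor _ (@P1_open_neq k Q).
split.
  apply: regular_reg Xo _ => x xQ; apply: (reg_ext (reg_cst c x));
    first by rewrite fc.
  by apply: (generic_mono (fibre_generic pi_quotient Q)) => y /fc.
exists (fun=> c^-1); split; first by apply: regular_reg Xo _ => x _; exact: reg_cst.
by move=> y /fc ->; rewrite mulfV.
Qed.

Lemma general_units (g : nat) : has_genus Y g -> (0 < g)%N ->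
  exists B : set (projective_line k), countable B /\
    forall Q : projective_line k, ~ B Q ->
      forall f : Y -> k,
        regular_unit [set y | pi y <> Q] f <->
        exists c : k, c != 0 /\ forall y, pi y <> Q -> f y = c.
Proof.
move=> Yg g0; have [w [y0 [d0 [rw w0]]]] := nonzero_form Yg g0.
have [Q0 _] := infinite_point_ex k.
exists (\bigcup_d ([set Q0] `|` [set Q | Q <> Q0 /\ exceptional Q0 d Q])); split.
  apply: bigcup_countable => // d _; apply: finite_set_countable.
  by rewrite finite_setU; split; [exact: finite_set1|exact: exceptional_finite rw
    w0].
move=> Q nQ f; split=> [uf|[c [c0 fc]]]; last exact: const_regular_unit fc.
have QQ0 : Q <> Q0 by move=> QQ0; apply: nQ; exists (0%N, 0, 0%N) => //; left.
have [[c fc]|[d ed]] := unit_exceptional QQ0 uf; last by case: nQ;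
  exists d => //; right.
exists c; split=> //; have [_ [u [_ fu]]] := uf.
have [y yQ] := generic_ex (fibre_generic pi_quotient Q).
by apply/eqP => c0; have /eqP := fu y yQ; rewrite fc // c0 mul0r eq_sym oner_eq0.
Qed.

End Units.

Theorem theorem3p5 (R : realType) (p : nat) (p_prime : prime p)
    (n : nat) (Y : set (projspace R[i] n))
    (Y_curve : nonsingular_projective_curve Y)
    (gT : finGroupType) (G : {group gT}) (sigma : gT)
    (G_cyclic : G = <[sigma]>%g :> {set gT}) (G_order : #|G| = p)
    (act : action G Y) (act_alg : algebraic_action act)
    (pi : Y -> projective_line R[i]) (pi_quotient : quotient_map act pi)
    (g : nat) (Y_genus : has_genus Y g) (g_gt0 : (0 < g)%N) :
  exists B : set (projective_line R[i]), countable B /\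
    forall Q : projective_line R[i], ~ B Q ->
      let X := [set y : Y | pi y <> Q]%classic in
      forall f : Y -> R[i],
        regular_unit X f <->
        exists c : R[i], c != 0%R /\ forall y, X y -> f y = c.
Proof.
have char0 : [pchar R[i]] =i pred0 by exact: pchar_num.
exact: (general_units char0 act_alg pi_quotient p_prime G_cyclic G_order Y_genus
  g_gt0).
Qed.
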